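(* Let $A,B\in\operatorname{EigSpSm}(2n)$. For every unitarily invariant norm $|\!|\!|\cdot|\!|\!|$ on the space of $2n\times 2n$ complex matrices, $$|\!|\!|\widehat{D}(A)-\widehat{D}(B)|\!|\!|\le\left(\|A_+^{1/2}\|+\|B_+^{1/2}\|\right)|\!|\!|\,|A_+-B_+|^{1/2}|\!|\!|+\left(\|A_-^{1/2}\|+\|B_-^{1/2}\|\right)|\!|\!|\,|A_--B_-|^{1/2}|\!|\!|.$$ In the special cases of the operator norm and the Frobenius norm, one gets $$\max_{1\le i\le n}|d_i(A)-d_i(B)|\le\left(\|A_+^{1/2}\|+\|B_+^{1/2}\|\right)\|A_+-B_+\|^{1/2}+\left(\|A_-^{1/2}\|+\|B_-^{1/2}\|\right)\|A_--B_-\|^{1/2}$$ and $$\sqrt2\left(\sum_{i=1}^n|d_i(A)-d_i(B)|^2\right)^{1/2}\le\left(\|A_+^{1/2}\|+\|B_+^{1/2}\|\right)\operatorname{Tr}(|A_+-B_+|)^{1/2}+\left(\|A_-^{1/2}\|+\|B_-^{1/2}\|\right)\operatorname{Tr}(|A_--B_-|)^{1/2}.$$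
   Context: $J=J_{2n}=\begin{pmatrix}0&I_n\\-I_n&0\end{pmatrix}$ and $\langle x,y\rangle=x^{\top}y$. For a subset $\mathscr{X}\subseteq\mathbb{R}^{2n}$, $\mathscr{X}^{\perp_{\operatorname{s}}}=\{u\in\mathbb{R}^{2n}:\langle u,Jv\rangle=0\ \forall v\in\mathscr{X}\}$. A linear subspace $\mathscr{W}$ is a symplectic subspace if $\mathscr{W}\cap\mathscr{W}^{\perp_{\operatorname{s}}}=\{0\}$ (the zero subspace is allowed). Symplectic subspaces $\mathscr{W},\mathscr{Z}$ are symplectically orthogonal to each other if $\mathscr{Z}\subseteq\mathscr{W}^{\perp_{\operatorname{s}}}$. For a $2n\times 2n$ real symmetric matrix $A$, let $\mathscr{E}_-,\mathscr{E}_0,\mathscr{E}_+$ be the subspaces spanned by the eigenvectors of $A$ corresponding to its negative, zero, and positive eigenvalues, respectively. $\operatorname{EigSpSm}(2n)$ is the set of $2n\times 2n$ real symmetric matrices $A$ for which $\mathscr{E}_-,\mathscr{E}_0,\mathscr{E}_+$ are pairwise symplectically orthogonal symplectic subspaces, each invariant under $JA$. For a matrix $X$, $|X|=(X^{*}X)^{1/2}$ is its absolute value (for real symmetric $X$, $|X|=(X^2)^{1/2}$). For a real symmetric $A$, $A_-=\frac12(|A|-A)$ and $A_+=\frac12(|A|+A)$, both positive semidefinite; $B^{1/2}$ is the positive semidefinite square root of a positive semidefinite $B$. $\|\cdot\|$ is the operator norm. A norm $|\!|\!|\cdot|\!|\!|$ on complex $2n\times 2n$ matrices is unitarily invariant if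 $|\!|\!|UXV|\!|\!|=|\!|\!|X|\!|\!|$ for all $X$ and all unitary $U,V$. For a Hermitian matrix $X$, $\operatorname{Eig}(X)$ is the diagonal matrix whose diagonal entries are the eigenvalues of $X$ (with multiplicity) arranged in decreasing order. For a $2n\times 2n$ real symmetric $A$, $$\widehat{D}(A)=\operatorname{Eig}\left(|A_+^{1/2}JA_+^{1/2}|\right)+\operatorname{Eig}\left(-|A_-^{1/2}JA_-^{1/2}|\right),$$ a $2n\times 2n$ diagonal matrix whose diagonal entries occur in consecutive equal pairs; they are denoted, in order, $d_1(A),d_1(A),d_2(A),d_2(A),\ldots,d_n(A),d_n(A)$. *)

(* Defs.v *)
From mathcomp Require Import all_boot all_order all_algebra.
From mathcomp Require Import all_classical all_reals.
From mathcomp Require Export complex.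
Set Implicit Arguments.
Unset Strict Implicit.
Unset Printing Implicit Defensive.
Import Order.TTheory GRing.Theory Num.Theory.
Local Open Scope classical_set_scope.
Local Open Scope ring_scope.

Definition dotv (R : realType) (m : nat) (x y : 'cV[R]_m) : R :=
  (x^T *m y) 0 0.

Definition Jmx (R : realType) (n : nat) : 'M[R]_(n + n) :=
  block_mx 0 1%:M (- 1%:M) 0.

Section Symplectic.
Context {R : realType} {n : nat}.
Implicit Types (W Z : set 'cV[R]_(n + n)) (A : 'M[R]_(n + n)).

Definition sperp W : set 'cV[R]_(n + n) :=
  [set u | forall v, W v -> dotv u (Jmx R n *m v) = 0].

Definition is_subspace W : Prop :=
  W 0 /\ forall (a : R) u v, W u -> W v -> W (a *: u + v).

Definition symplectic_subspace W : Prop :=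
  is_subspace W /\ W `&` sperp W = [set 0].

Definition symplectically_orthogonal W Z : Prop := Z `<=` sperp W.

Definition invariant_under A W : Prop := forall v, W v -> W (A *m v).

Definition linear_span W : set 'cV[R]_(n + n) :=
  [set x | exists (k : nat) (c : 'I_k -> R) (v : 'I_k -> 'cV[R]_(n + n)),
     (forall i, W (v i)) /\ x = \sum_(i < k) c i *: v i].

Definition eigenvector A (a : R) (v : 'cV[R]_(n + n)) : Prop :=
  v <> 0 /\ A *m v = a *: v.

Definition Eneg A := linear_span [set v | exists2 a : R, a < 0 & eigenvector A a v].
Definition Ezero A := linear_span [set v | eigenvector A 0 v].
Definition Epos A := linear_span [set v | exists2 a : R, 0 < a & eigenvector A a v].

Definition EigSpSm A : Prop :=
  [/\ A^T = A,
      [/\ symplectic_subspace (Eneg A), symplectic_subspace (Ezero A)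
        & symplectic_subspace (Epos A)],
      [/\ symplectically_orthogonal (Eneg A) (Ezero A),
          symplectically_orthogonal (Eneg A) (Epos A)
        & symplectically_orthogonal (Ezero A) (Epos A)]
    & [/\ invariant_under (Jmx R n *m A) (Eneg A),
          invariant_under (Jmx R n *m A) (Ezero A)
        & invariant_under (Jmx R n *m A) (Epos A)]].

End Symplectic.

Section MatrixFunctions.
Context {R : realType} {m : nat}.
Implicit Types A B X : 'M[R]_m.

Definition psd B : Prop := B^T = B /\ forall x : 'cV[R]_m, 0 <= dotv x (B *m x).

(* The positive semidefinite square root, chosen by its defining property;
   0 is the default value when B is not positive semidefinite. *)
Definition sqrtmx B : 'M[R]_m := xget 0 [set S | psd S /\ S *m S = B].

(* For a real X the adjoint is the transpose. *)
Definition absmx X : 'M[R]_m := sqrtmx (X^T *m X).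

Definition negpart A : 'M[R]_m := 2^-1 *: (absmx A - A).
Definition pospart A : 'M[R]_m := 2^-1 *: (absmx A + A).

(* The eigenvalues with multiplicity, in decreasing order: the only such row
   listing the roots of the characteristic polynomial, which splits over R when
   X is symmetric. *)
Definition eigvals X : 'rV[R]_m :=
  xget (0 : 'rV[R]_m) [set d : 'rV[R]_m | (forall i j : 'I_m, (i <= j)%N -> d 0 j <= d 0 i) /\
                  char_poly X = \prod_(i < m) ('X - (d 0 i)%:P)].

Definition Eig X : 'M[R]_m := diag_mx (eigvals X).

Definition l2norm (x : 'cV[R]_m) : R := Num.sqrt (dotv x x).

Definition opnorm X : R :=
  sup [set r | exists2 x : 'cV[R]_m, l2norm x <= 1 & r = l2norm (X *m x)].

End MatrixFunctions.

Definition toC (R : realType) (m : nat) (X : 'M[R]_m) : 'M[R[i]]_m :=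
  map_mx (real_complex R) X.

Record unitarily_invariant_norm (R : realType) (m : nat)
    (N : 'M[R[i]]_m -> R) : Prop := UnitarilyInvariantNorm {
  uin_ge0 : forall X, 0 <= N X;
  uin_eq0 : forall X, N X = 0 -> X = 0;
  uin_scale : forall (a : R[i]) X, N (a *: X) = ComplexField.Normc.normc a * N X;
  uin_triangle : forall X Y, N (X + Y) <= N X + N Y;
  uin_unitary : forall U X V, U \is unitarymx -> V \is unitarymx ->
    N (U *m X *m V) = N X }.

Section SymplecticEigenvalues.
Context {R : realType} {n : nat}.
Implicit Types A : 'M[R]_(n + n).

Definition Dhat A : 'M[R]_(n + n) :=
  let Ap := sqrtmx (pospart A) in
  let Am := sqrtmx (negpart A) in
  Eig (absmx (Ap *m Jmx R n *m Ap)) + Eig (- absmx (Am *m Jmx R n *m Am)).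

Lemma double_idx_subproof (i : 'I_n) : (i.*2 < n + n)%N.
Proof. by rewrite addnn ltn_double. Qed.

(* The diagonal of Dhat A reads d_1, d_1, d_2, d_2, ..., d_n, d_n; with indices
   counted from 0, the entry number i is taken at the first place of its pair. *)
Definition sympd A (i : 'I_n) : R :=
  Dhat A (Ordinal (double_idx_subproof i)) (Ordinal (double_idx_subproof i)).

End SymplecticEigenvalues.

(* Main.v *)
Require Import Defs.
From mathcomp Require Import all_boot all_order all_algebra.
From mathcomp Require Import all_classical all_reals.
From mathcomp Require Import perm zify ring lra.
Import Order.TTheory GRing.Theory Num.Theory.
Local Open Scope ring_scope.

Set Implicit Arguments.
Unset Strict Implicit.
Unset Printing Implicit Defensive.

(** Write [S_A] for the square root of the positive part of [A] and [X_A] for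
    [S_A J S_A].  The first summand of [Dhat A] lists the singular values of
    [X_A] in decreasing order; the second lists those of the analogous matrix
    of the negative part, with a minus sign and in reverse order.  The bound is
    obtained for the two summands separately, by three norm inequalities that
    hold for every orthogonally invariant norm [N] on real matrices:

    - [mirsky]: singular values in decreasing order are contractive, so the
      first summand changes by at most [N (X_A - X_B)];
    - [oin_mull_opnorm] and [oin_mulr_opnorm]: since
      [X_A - X_B = S_A J (S_A - S_B) + (S_A - S_B) J S_B] and [J] is orthogonal,
      this is at most [(opnorm S_A + opnorm S_B) * N (S_A - S_B)];
    - [sqrtmx_perturbation]: [N (sqrt P - sqrt Q) <= N (sqrt |P - Q|)] for
      positive semidefinite [P] and [Q].

    A unitarily invariant norm on complex matrices restricts to an orthogonally
    invariant one on real matrices, where all matrices at hand live, and the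
    operator and Frobenius norms are orthogonally invariant.  This gives all
    three claims; the factor [sqrt 2] of the last one comes from
    [skew_singular_pairs], the singular values of the real skew-symmetric
    matrix [X_A] being equal in consecutive pairs.

    Both [mirsky] and [sqrtmx_perturbation] are weak majorizations.  They are
    proved in the form of an inequality between the sums of the excesses
    [(|x_i| - t)_+], for every [t >= 0], and [fan_dominance] turns such
    inequalities into norm inequalities.  The excess sum is the distance to the
    matrices of operator norm at most [t], measured in the trace norm; so each
    majorization is an interpolation between two extreme cases, one for the
    operator norm, which follows from operator inequalities, and one for the
    trace norm, which follows from properties of the trace. *)

(** * Orthogonal matrices *)

Section Orthogonal.
Context {R : realType}.

Definition orthogonal_mx m (U : 'M[R]_m) : Prop := U^T *m U = 1%:M.

Lemma orthogonal_mxV m (U : 'M[R]_m) : orthogonal_mx U -> U *m U^T = 1%:M.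
Proof. exact: mulmx1C. Qed.

Lemma orthogonal_tr m (U : 'M[R]_m) : orthogonal_mx U -> orthogonal_mx U^T.
Proof. by move=> oU; rewrite /orthogonal_mx trmxK; apply: orthogonal_mxV. Qed.

Lemma orthogonal1 m : orthogonal_mx (1%:M : 'M[R]_m).
Proof. by rewrite /orthogonal_mx trmx1 mul1mx. Qed.

Lemma orthogonalM m (U V : 'M[R]_m) :
  orthogonal_mx U -> orthogonal_mx V -> orthogonal_mx (U *m V).
Proof.
move=> oU oV.
by rewrite /orthogonal_mx trmx_mul -mulmxA [U^T *m _]mulmxA oU mul1mx.
Qed.

Lemma orthogonal_perm m (s : 'S_m) : orthogonal_mx (perm_mx s : 'M[R]_m).
Proof. by rewrite /orthogonal_mx tr_perm_mx -perm_mxM mulVg perm_mx1. Qed.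

Lemma orthogonal_sign m (e : 'I_m -> bool) :
  orthogonal_mx (diag_mx (\row_i (-1) ^+ e i) : 'M[R]_m).
Proof.
rewrite /orthogonal_mx tr_diag_mx mulmx_diag -diag_const_mx.
by congr diag_mx; apply/rowP => i; rewrite !mxE -expr2 sqrr_sign.
Qed.

Lemma orthogonal_block m1 m2 (U : 'M[R]_m1) (V : 'M[R]_m2) :
  orthogonal_mx U -> orthogonal_mx V -> orthogonal_mx (block_mx U 0 0 V).
Proof.
move=> oU oV; rewrite /orthogonal_mx tr_block_mx mulmx_block.
by rewrite !trmx0 !mulmx0 !mul0mx oU oV !addr0 !add0r -scalar_mx_block.
Qed.

(** ** Inner products *)

Lemma dotvE m (x y : 'cV[R]_m) : dotv x y = \sum_i x i 0 * y i 0.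
Proof. by rewrite /dotv mxE; apply: eq_bigr => i _; rewrite mxE. Qed.

Lemma dotv_scalar_mx m (x y : 'cV[R]_m) : x^T *m y = (dotv x y)%:M.
Proof. by rewrite /dotv -mx11_scalar. Qed.

Lemma dotvC m (x y : 'cV[R]_m) : dotv x y = dotv y x.
Proof. by rewrite !dotvE; apply: eq_bigr => i _; rewrite mulrC. Qed.

Lemma dotvDr m (x y z : 'cV[R]_m) : dotv x (y + z) = dotv x y + dotv x z.
Proof. by rewrite /dotv mulmxDr mxE. Qed.

Lemma dotvNr m (x y : 'cV[R]_m) : dotv x (- y) = - dotv x y.
Proof. by rewrite /dotv mulmxN mxE. Qed.

Lemma dotvBr m (x y z : 'cV[R]_m) : dotv x (y - z) = dotv x y - dotv x z.
Proof. by rewrite dotvDr dotvNr. Qed.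

Lemma dotvZr m a (x y : 'cV[R]_m) : dotv x (a *: y) = a * dotv x y.
Proof. by rewrite /dotv -scalemxAr mxE. Qed.

Lemma dotvZl m a (x y : 'cV[R]_m) : dotv (a *: x) y = a * dotv x y.
Proof. by rewrite dotvC dotvZr dotvC. Qed.

Lemma dotvBl m (x y z : 'cV[R]_m) : dotv (y - z) x = dotv y x - dotv z x.
Proof. by rewrite dotvC dotvBr [dotv x y]dotvC [dotv x z]dotvC. Qed.

Lemma dotv_mull m n (M : 'M[R]_(m, n)) x y : dotv (M *m x) y = dotv x (M^T *m y).
Proof. by rewrite /dotv trmx_mul mulmxA. Qed.

Lemma dotv_mulr m n (M : 'M[R]_(m, n)) x y : dotv x (M *m y) = dotv (M^T *m x) y.
Proof. by rewrite dotv_mull trmxK. Qed.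

Lemma dotv_ge0 m (x : 'cV[R]_m) : 0 <= dotv x x.
Proof. by rewrite dotvE sumr_ge0 // => i _; rewrite -expr2 sqr_ge0. Qed.

Lemma dotv_eq0 m (x : 'cV[R]_m) : dotv x x = 0 -> x = 0.
Proof.
rewrite dotvE => /eqP; rewrite psumr_eq0 => [/allP x0|i _]; last first.
  by rewrite -expr2 sqr_ge0.
apply/colP => i; have := x0 i (mem_index_enum i).
by rewrite /= mulf_eq0 orbb mxE => /eqP.
Qed.

Lemma dotv_gt0 m (x : 'cV[R]_m) : x != 0 -> 0 < dotv x x.
Proof.
by move=> x0; rewrite lt_neqAle dotv_ge0 andbT eq_sym;
  apply: contra x0 => /eqP/dotv_eq0 ->.
Qed.

Lemma dotv_orthogonal m (U : 'M[R]_m) x y :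
  orthogonal_mx U -> dotv (U *m x) (U *m y) = dotv x y.
Proof. by move=> oU; rewrite dotv_mull mulmxA oU mul1mx. Qed.

Lemma unit_vector m (x : 'cV[R]_m) :
  x != 0 -> exists2 c : R, c != 0 & dotv (c *: x) (c *: x) = 1.
Proof.
move=> /dotv_gt0 x0; exists (Num.sqrt (dotv x x))^-1.
  by rewrite invr_eq0 sqrtr_eq0 -ltNge.
rewrite dotvZr dotvZl mulrA -expr2 exprVn sqr_sqrtr ?ltW //.
by rewrite mulVf // gt_eqF.
Qed.

(** The Householder reflection that exchanges the first basis vector and [u]. *)
Lemma orthogonal_first_column m (u : 'cV[R]_(1 + m)) :
  dotv u u = 1 -> exists2 Q, orthogonal_mx Q & Q *m delta_mx 0 0 = u.
Proof.
move=> u1; set e : 'cV[R]_(1 + m) := delta_mx 0 0.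
have e1 : dotv e e = 1.
  rewrite dotvE (bigD1 0) //= big1 ?addr0 ?mxE ?mulr1 // => i /negPf i0.
  by rewrite !mxE i0 mul0r.
have [eu|] := eqVneq (e - u) 0.
  exists 1%:M; first exact: orthogonal1.
  by rewrite mul1mx; apply/eqP; rewrite -subr_eq0 eu.
set w := e - u => /dotv_gt0; set s := dotv w w => s_gt0.
have s0 : s != 0 by rewrite gt_eqF.
(* Both [e] and [u] are unit vectors: this makes the reflection in the
   hyperplane orthogonal to [w] exchange them. *)
have we : 2 * dotv w e = s.
  rewrite /s {2}/w dotvBr /w !dotvBl e1 u1 [dotv e u]dotvC; ring.
pose Q : 'M[R]_(1 + m) := 1%:M - (2 / s) *: (w *m w^T).
exists Q; last first.
  rewrite mulmxBl mul1mx -scalemxAl -mulmxA.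
  rewrite dotv_scalar_mx -scalemx1 -scalemxAr mulmx1 scalerA mulrAC we divff // scale1r.
  by rewrite /w opprB addrC subrK.
have QT : Q^T = Q.
  by rewrite linearB /= trmx1 linearZ /= trmx_mul trmxK.
rewrite /orthogonal_mx QT {1}/Q mulmxBl mul1mx /Q mulmxBr mulmx1.
rewrite -!scalemxAl -!scalemxAr.
have -> : w *m w^T *m (w *m w^T) = s *: (w *m w^T).
  rewrite mulmxA -[w *m w^T *m w]mulmxA dotv_scalar_mx.
  by rewrite mul_mx_scalar scalemxAl.
move: (w *m w^T) => M; apply/matrixP => i j; rewrite !mxE.
by field.
Qed.

End Orthogonal.

Arguments orthogonal1 {R} m.

(** * Diagonalization *)

Section Diagonalization.
Context {R : realType}.

(** The matrix has an eigenvalue over [R[i]], where it is Hermitian, so that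
    eigenvalue is real and a root of the real characteristic polynomial. *)
Lemma symmetric_eigenvector m (A : 'M[R]_m.+1) :
  A^T = A -> exists a v, dotv v v = 1 /\ A *m v = a *: v.
Proof.
move=> AT; pose AC := toC A.
have hA : AC \is hermsymmx.
  apply: realsym_hermsym; last first.
    by apply/mxOverP => i j; rewrite mxE complex_real.
  apply/is_hermitianmxP; rewrite expr0 scale1r.
  by apply/matrixP => i j; rewrite !mxE -{1}AT mxE.
have /orthomx_spectralP E := hermitian_normalmx hA.
have rA := hermitian_spectral_diag_real hA.
set P := spectralmx AC in E; set sp := spectral_diag AC in E rA.
have Pu : P \in unitmx := spectral_unit AC.
have [a Ea] := complex_realP _ (mxOverP rA 0 0).
have : eigenvalue AC (a%:C%C).
  apply/eigenvalueP; exists (row 0 P).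
    rewrite -row_mul {1}E !mulmxA mulmxV // mul1mx.
    by apply/rowP => j; rewrite row_mul !mxE (bigD1 0) //= big1 => [|i /negPf i0];
      rewrite ?addr0 ?mxE ?eqxx ?mulr1n ?Ea // eq_sym i0 mulr0n mul0r.
  apply/eqP => r0; move: Pu; rewrite -row_free_unit => /row_freeP[Q PQ].
  have /rowP/(_ 0) : row 0 (P *m Q) = 0 by rewrite row_mul r0 mul0mx.
  by rewrite PQ !mxE => /eqP; rewrite oner_eq0.
rewrite eigenvalue_root_char /AC /toC -map_char_poly fmorph_root.
rewrite -eigenvalue_root_char => /eigenvalueP[v vA v0].
have [c c0 c1] : exists2 c : R, c != 0 & dotv (c *: v^T) (c *: v^T) = 1.
  by apply: unit_vector; rewrite trmx_eq0.
exists a, (c *: v^T); split => //.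
by rewrite -scalemxAr -{1}AT -trmx_mul vA linearZ /= scalerA mulrC -scalerA.
Qed.

(** Both spectral theorems below are deflations: when a unit vector [v] goes to
    a multiple of [u], and [u] goes back to a multiple of [v] under the
    transpose, the matrix splits off a one-dimensional block. *)
Lemma deflation m (X Qu Qv : 'M[R]_(1 + m)) s :
  orthogonal_mx Qu -> orthogonal_mx Qv ->
  X *m (Qv *m delta_mx 0 0) = s *: (Qu *m delta_mx 0 0 : 'cV_(1 + m)) ->
  X^T *m (Qu *m delta_mx 0 0) = s *: (Qv *m delta_mx 0 0 : 'cV_(1 + m)) ->
  Qu^T *m X *m Qv = block_mx s%:M 0 0 (drsubmx (Qu^T *m X *m Qv)).
Proof.
move=> oU oV Xv Xu; set Y := Qu^T *m X *m Qv.
have Y1 : Y *m delta_mx 0 0 = s *: (delta_mx 0 0 : 'cV_(1 + m)).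
  by rewrite /Y -!mulmxA Xv -scalemxAr mulmxA oU mul1mx.
have Y2 : Y^T *m delta_mx 0 0 = s *: (delta_mx 0 0 : 'cV_(1 + m)).
  by rewrite /Y !trmx_mul trmxK -!mulmxA Xu -scalemxAr mulmxA oV mul1mx.
have c0 i : Y i 0 = s * (i == 0)%:R.
  by have /colP/(_ i) := Y1; rewrite -colE !mxE eqxx andbT.
have r0 i : Y 0 i = s * (i == 0)%:R.
  by have /colP/(_ i) := Y2; rewrite -colE !mxE eqxx andbT.
have l0 : lshift m (0 : 'I_1) = 0 :> 'I_(1 + m) by apply/val_inj.
clearbody Y; rewrite -{1}[Y]submxK; congr block_mx; apply/matrixP => i j.
- by rewrite !mxE !ord1 l0 c0 eqxx mulr1 mulr1n.
- by rewrite !mxE !ord1 l0 r0 mulr0.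
- by rewrite !mxE !ord1 l0 c0 mulr0.
Qed.

Definition extend_block m (U : 'M[R]_m) : 'M[R]_(1 + m) := block_mx 1%:M 0 0 U.

Lemma orthogonal_extend_block m (U : 'M[R]_m) :
  orthogonal_mx U -> orthogonal_mx (extend_block U).
Proof. by move=> oU; apply: orthogonal_block => //; exact: orthogonal1. Qed.

Lemma undeflation m (X P Q : 'M[R]_(1 + m)) U V s (d : 'rV_m) :
  orthogonal_mx P -> orthogonal_mx Q ->
  P^T *m X *m Q = block_mx s%:M 0 0 (U *m diag_mx d *m V^T) ->
  X = P *m extend_block U *m diag_mx (row_mx (const_mx s : 'rV_1) d)
        *m (Q *m extend_block V)^T.
Proof.
move=> oP oQ E.
transitivity (P *m (P^T *m X *m Q) *m Q^T).
  rewrite !mulmxA orthogonal_mxV // mul1mx -mulmxA.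
  by rewrite orthogonal_mxV // mulmx1.
rewrite E diag_mx_row trmx_mul tr_block_mx !trmx0 trmx1 diag_const_mx.
rewrite -!mulmxA; congr (P *m _); rewrite !mulmxA; congr (_ *m Q^T).
rewrite !mulmx_block.
by rewrite !mulmx0 !mul0mx !mulmx1 !mul1mx !addr0 !add0r mul0mx.
Qed.

Lemma spectral m (A : 'M[R]_m) : A^T = A ->
  exists U d, orthogonal_mx U /\ A = U *m diag_mx d *m U^T.
Proof.
elim: m A => [|m IH] A AT.
  by exists 1%:M, 0; split; [exact: orthogonal1|rewrite [RHS]flatmx0 flatmx0].
have [a [v [v1 Av]]] := symmetric_eigenvector AT.
have [Q oQ Qv] := orthogonal_first_column (v1 : dotv (v : 'cV_(1 + m)) v = 1).
have := @deflation m A Q Q a oQ oQ; rewrite Qv AT => /(_ Av Av).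
set B := drsubmx _ => EB.
have BT : B^T = B.
  by rewrite /B trmx_drsub !trmx_mul trmxK AT mulmxA.
have [U [d [oU Ed]]] := IH B BT.
exists (Q *m extend_block U), (row_mx (const_mx a : 'rV_1) d); split.
  by apply: orthogonalM => //; exact: orthogonal_extend_block.
by apply: undeflation => //; rewrite -Ed.
Qed.

(** When [X] kills [v], the partner of [v] is a unit vector of the kernel of
    the transpose of [X], which exists because [X] is singular. *)
Lemma singular_vectors m (X : 'M[R]_m.+1) : exists s u v,
  [/\ 0 <= s, dotv u u = 1, dotv v v = 1, X *m v = s *: u & X^T *m u = s *: v].
Proof.
have [|a [v [v1 av]]] := @symmetric_eigenvector m (X^T *m X).
  by rewrite trmx_mul trmxK.
have aE : dotv (X *m v) (X *m v) = a.
  by rewrite dotv_mull mulmxA av dotvZr v1 mulr1.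
have [Xv0|Xv] := eqVneq (X *m v) 0.
  have [w w0 wX] : exists2 w : 'rV_m.+1, w != 0 & w *m X = 0.
    have dX : \det X = 0.
      rewrite -det_tr; apply/eqP/det0P; exists v^T.
        rewrite trmx_eq0; apply/eqP => v0; move/eqP: v1.
        by rewrite v0 /dotv mulmx0 mxE eq_sym oner_eq0.
      by rewrite -trmx_mul Xv0 trmx0.
    by move/eqP: dX => /det0P.
  have [c c0 c1] : exists2 c : R, c != 0 & dotv (c *: w^T) (c *: w^T) = 1.
    by apply: unit_vector; rewrite trmx_eq0.
  exists 0, (c *: w^T), v; split; rewrite ?scale0r //.
  by rewrite -scalemxAr -trmx_mul wX trmx0 scaler0.
have a0 : 0 < a by rewrite -aE dotv_gt0.
have s0 : Num.sqrt a != 0 by rewrite sqrtr_eq0 -ltNge.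
exists (Num.sqrt a), ((Num.sqrt a)^-1 *: (X *m v)), v; split.
- exact: sqrtr_ge0.
- rewrite dotvZr dotvZl aE mulrA -expr2 exprVn sqr_sqrtr ?ltW //.
  by rewrite mulVf // gt_eqF.
- by [].
- by rewrite scalerA divff // scale1r.
- rewrite -scalemxAr mulmxA av scalerA; congr (_ *: _).
  by rewrite -{2}(sqr_sqrtr (ltW a0)) expr2 mulKf.
Qed.

Lemma singular_value_decomposition m (X : 'M[R]_m) :
  exists (U V : 'M[R]_m) (d : 'rV[R]_m),
  [/\ orthogonal_mx U, orthogonal_mx V, forall i, 0 <= d 0 i
    & X = U *m diag_mx d *m V^T].
Proof.
elim: m X => [|m IH] X.
  exists 1%:M, 1%:M, 0; split; try exact: orthogonal1.
    by move=> i; rewrite mxE.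
  by rewrite [RHS]flatmx0 flatmx0.
have [s [u [v [s0 u1 v1 Xv Xu]]]] := singular_vectors X.
have [P oP Pu] := orthogonal_first_column (u1 : dotv (u : 'cV_(1 + m)) u = 1).
have [Q oQ Qv] := orthogonal_first_column (v1 : dotv (v : 'cV_(1 + m)) v = 1).
have := @deflation m X P Q s oP oQ; rewrite Pu Qv => /(_ Xv Xu).
set B := drsubmx _ => EB.
have [U [V [d [oU oV d0 Ed]]]] := IH B.
exists (P *m extend_block U), (Q *m extend_block V).
exists (row_mx (const_mx s : 'rV_1) d); split.
- by apply: orthogonalM => //; exact: orthogonal_extend_block.
- by apply: orthogonalM => //; exact: orthogonal_extend_block.
- by move=> i; rewrite mxE; case: splitP => j _; rewrite ?mxE.
- by apply: undeflation => //; rewrite -Ed.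
Qed.

End Diagonalization.
(** * Rearrangement in decreasing order *)

Section Sorting.
Context {R : realType}.

Definition decreasing_row m (d : 'rV[R]_m) : Prop :=
  forall i j : 'I_m, (i <= j)%N -> d 0 j <= d 0 i.

Lemma exists_sorting_perm m (d : 'rV[R]_m) :
  exists s : 'S_m, decreasing_row (col_perm s d).
Proof.
pose leT (i j : 'I_m) := d 0 j <= d 0 i.
have leT_total : total leT by move=> i j; apply: le_total.
have leT_trans : transitive leT by move=> i j k ij jk; apply: le_trans jk ij.
pose t := sort leT (enum 'I_m).
have szt : size t = m by rewrite size_sort size_enum_ord.
have uniqt : uniq t by rewrite sort_uniq enum_uniq.
have sortt : sorted leT t by exact: sort_sorted.
pose f (i : 'I_m) := nth i t i.
have fE (x i : 'I_m) : f i = nth x t i.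
  by apply: set_nth_default; rewrite szt.
have f_inj : injective f.
  move=> i j; rewrite (fE i) (fE i j) => /eqP.
  by rewrite nth_uniq ?szt // => /eqP /val_inj.
exists (perm f_inj) => i j ij; rewrite !mxE !permE (fE i j) (fE i i).
by apply: (sorted_leq_nth leT_trans _ i sortt); rewrite ?inE ?szt // => k;
  rewrite /leT.
Qed.

Lemma diag_col_perm m (s : 'S_m) (d : 'rV[R]_m) :
  diag_mx (col_perm s d) = perm_mx s *m diag_mx d *m (perm_mx s)^T.
Proof.
rewrite tr_perm_mx -row_permE -col_permE.
by apply/matrixP => i j; rewrite !mxE (inj_eq perm_inj).
Qed.

Lemma spectral_sorted m (A : 'M[R]_m) : A^T = A -> exists U d,
  [/\ orthogonal_mx U, decreasing_row d & A = U *m diag_mx d *m U^T].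
Proof.
move=> /spectral[U [d [oU ->]]]; have [s sd] := exists_sorting_perm d.
exists (U *m (perm_mx s)^T), (col_perm s d); split => //.
  by apply: orthogonalM => //; apply: orthogonal_tr; exact: orthogonal_perm.
rewrite diag_col_perm trmx_mul trmxK !mulmxA -[U *m _ *m perm_mx s]mulmxA.
rewrite orthogonal_perm mulmx1 -[_ *m _ *m perm_mx s]mulmxA.
by rewrite orthogonal_perm mulmx1.
Qed.

Lemma singular_value_decomposition_sorted m (X : 'M[R]_m) :
  exists (U V : 'M[R]_m) (d : 'rV[R]_m),
  [/\ orthogonal_mx U, orthogonal_mx V, forall i, 0 <= d 0 i,
      decreasing_row d & X = U *m diag_mx d *m V^T].
Proof.
have [U [V [d [oU oV d0 ->]]]] := singular_value_decomposition X.
have [s sd] := exists_sorting_perm d.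
exists (U *m (perm_mx s)^T), (V *m (perm_mx s)^T), (col_perm s d); split => //.
- by apply: orthogonalM => //; apply: orthogonal_tr; exact: orthogonal_perm.
- by apply: orthogonalM => //; apply: orthogonal_tr; exact: orthogonal_perm.
- by move=> i; rewrite mxE.
rewrite diag_col_perm trmx_mul trmxK !mulmxA -[U *m _ *m perm_mx s]mulmxA.
rewrite orthogonal_perm mulmx1 -[_ *m _ *m perm_mx s]mulmxA.
by rewrite orthogonal_perm mulmx1.
Qed.

Lemma char_poly_conj m (U M : 'M[R]_m) :
  orthogonal_mx U -> char_poly (U *m M *m U^T) = char_poly M.
Proof.
move=> oU; rewrite /char_poly /char_poly_mx.
have pU : map_mx polyC U *m (map_mx polyC U)^T = 1%:M.
  by rewrite map_trmx -map_mxM orthogonal_mxV // map_mx1.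
have -> : 'X%:M - map_mx polyC (U *m M *m U^T) =
    map_mx polyC U *m ('X%:M - map_mx polyC M) *m (map_mx polyC U)^T.
  rewrite mulmxBr mulmxBl !map_mxM map_trmx; congr (_ - _).
  by rewrite mul_mx_scalar -scalemxAl -map_trmx pU scalemx1.
by rewrite !det_mulmx mulrAC -det_mulmx pU det1 mul1r.
Qed.

Lemma char_poly_diag m (d : 'rV[R]_m) :
  char_poly (diag_mx d) = \prod_(i < m) ('X - (d 0 i)%:P).
Proof.
rewrite char_poly_trig ?diag_mx_is_trig //.
by apply: eq_bigr => i _; rewrite mxE eqxx mulr1n.
Qed.

Lemma decreasing_row_unique m (c d : 'rV[R]_m) :
  decreasing_row c -> decreasing_row d ->
  \prod_(i < m) ('X - (c 0 i)%:P) = \prod_(i < m) ('X - (d 0 i)%:P) -> c = d.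
Proof.
move=> cs ds E.
pose l (e : 'rV[R]_m) := [seq e 0 i | i <- enum 'I_m].
have lE (e : 'rV_m) : \prod_(i < m) ('X - (e 0 i)%:P) = \prod_(x <- l e) ('X - x%:P).
  by rewrite big_map big_enum.
have nl (e : 'rV_m) (i : 'I_m) : nth 0 (l e) i = e 0 i.
  by rewrite (nth_map i) ?size_enum_ord ?nth_ord_enum.
have sl e : decreasing_row e -> sorted (fun x y => y <= x) (l e).
  move=> es; apply/(sortedP 0) => k; rewrite size_map size_enum_ord => km.
  by rewrite (nl e (Ordinal (ltnW km))) (nl e (Ordinal km)); apply: es => /=.
have pe : perm_eq (l c) (l d) by apply: prod_XsubC_eq; rewrite -!lE.
have lcd : l c = l d.
  apply: sorted_eq (sl c cs) (sl d ds) pe.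
  - by move=> x y z xy yz; apply: le_trans yz xy.
  - by move=> x y; rewrite andbC; exact: le_anti.
by apply/rowP => i; rewrite -!nl lcd.
Qed.

Lemma eigvals_conj m (U : 'M[R]_m) d :
  orthogonal_mx U -> decreasing_row d -> eigvals (U *m diag_mx d *m U^T) = d.
Proof.
move=> oU ds; apply: xget_unique => [|c [cs cE]].
  by split => //; rewrite char_poly_conj // char_poly_diag.
by apply: decreasing_row_unique => //; rewrite -cE char_poly_conj // char_poly_diag.
Qed.

End Sorting.

(** * Positive semidefinite matrices *)

Section PositiveSemidefinite.
Context {R : realType} {m : nat}.
Implicit Types (A B S T U V X : 'M[R]_m) (d : 'rV[R]_m).

Lemma psd_diag_mx d : (forall i, 0 <= d 0 i) -> psd (diag_mx d).
Proof.
move=> d0; split; first exact: tr_diag_mx.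
move=> x; rewrite dotvE; apply: sumr_ge0 => i _; rewrite mul_diag_mx mxE.
by rewrite mulrCA mulr_ge0 // -expr2 sqr_ge0.
Qed.

Lemma psd_congruence n A (M : 'M[R]_(m, n)) : psd A -> psd (M^T *m A *m M).
Proof.
move=> [AT A0]; split; first by rewrite !trmx_mul trmxK AT mulmxA.
by move=> x; rewrite -!mulmxA dotv_mulr trmxK.
Qed.

Lemma psd_conj U A : psd A -> psd (U *m A *m U^T).
Proof. by move=> /(psd_congruence U^T); rewrite trmxK. Qed.

Lemma psd_diag_entry A i : psd A -> 0 <= A i i.
Proof.
move=> [_ /(_ (delta_mx i 0))]; rewrite /dotv trmx_delta -colE -rowE.
by rewrite !mxE.
Qed.

Lemma psdD A B : psd A -> psd B -> psd (A + B).
Proof.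
move=> [AT A0] [BT B0]; split; first by rewrite linearD /= AT BT.
by move=> x; rewrite mulmxDl dotvDr addr_ge0.
Qed.

Lemma psdZ a A : 0 <= a -> psd A -> psd (a *: A).
Proof.
move=> a0 [AT A0]; split; first by rewrite linearZ /= AT.
by move=> x; rewrite -scalemxAl dotvZr mulr_ge0.
Qed.

Lemma psd_gram A : psd (A^T *m A).
Proof.
split; first by rewrite trmx_mul trmxK.
by move=> x; rewrite -mulmxA dotv_mulr trmxK dotv_ge0.
Qed.

Lemma psd_sqr A : psd A -> psd (A *m A).
Proof. by move=> [AT _]; rewrite -{1}AT; exact: psd_gram. Qed.

Lemma psd0 : psd (0 : 'M[R]_m).
Proof.
by split; rewrite ?trmx0 // => x; rewrite mul0mx /dotv mulmx0 mxE.
Qed.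

Lemma psd_scalar a : 0 <= a -> psd (a%:M : 'M[R]_m).
Proof.
by move=> a0; rewrite -diag_const_mx; apply: psd_diag_mx => i; rewrite mxE.
Qed.

Lemma conj_congruence U A : orthogonal_mx U -> U^T *m (U *m A *m U^T) *m U = A.
Proof. by move=> oU; rewrite !mulmxA oU mul1mx -mulmxA oU mulmx1. Qed.

Lemma psd_spectral_ge0 U d i :
  orthogonal_mx U -> psd (U *m diag_mx d *m U^T) -> 0 <= d 0 i.
Proof.
move=> oU /(psd_congruence U); rewrite conj_congruence //.
by move=> /psd_diag_entry => /(_ i); rewrite mxE eqxx mulr1n.
Qed.

Lemma psd_spectral A : psd A -> exists U d,
  [/\ orthogonal_mx U, forall i, 0 <= d 0 i & A = U *m diag_mx d *m U^T].
Proof.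
move=> pA; have [U [d [oU Ed]]] := spectral pA.1; exists U, d; split => // i.
by apply: (psd_spectral_ge0 (U := U)) => //; rewrite -Ed.
Qed.

Lemma psd_anti A : psd A -> psd (- A) -> A = 0.
Proof.
move=> pA nA; have [U [d [oU Ed]]] := spectral pA.1.
suff d0 : d = 0 by rewrite Ed d0 (_ : diag_mx 0 = 0) ?mulmx0 ?mul0mx //; exact: raddf0.
apply/rowP => i; rewrite mxE; apply/le_anti; apply/andP; split.
  rewrite -oppr_ge0; have : psd (U *m diag_mx (- d) *m U^T).
    by rewrite linearN /= mulmxN mulNmx -Ed.
  by move=> /psd_spectral_ge0 => /(_ i oU); rewrite mxE.
by apply: (psd_spectral_ge0 (U := U)) => //; rewrite -Ed.
Qed.

(** The square root is operator monotone.  At a unit eigenvector [u] of [T - S]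
    with eigenvalue [d], the form of [T^2 - S^2] is [2 d <u, T u> - d^2], so a
    negative [d] would make it negative. *)
Lemma psd_sqrt_monotone S T : psd S -> psd T -> psd (T *m T - S *m S) -> psd (T - S).
Proof.
move=> pS pT pTS.
have [|U [d [oU Ed]]] := @spectral R m (T - S).
  by rewrite linearB /= pS.1 pT.1.
suff d0 i : 0 <= d 0 i by rewrite Ed; apply: psd_conj; exact: psd_diag_mx.
have ES : S = T - U *m diag_mx d *m U^T by rewrite -Ed opprB addrC subrK.
have [T' Tc T'0] : exists2 T', T = U *m T' *m U^T & psd T'.
  exists (U^T *m T *m U); last exact: psd_congruence.
  by rewrite !mulmxA orthogonal_mxV // mul1mx -mulmxA orthogonal_mxV // mulmx1.
have UU (X Y : 'M_m) :
    (U *m X *m U^T) *m (U *m Y *m U^T) = U *m (X *m Y) *m U^T.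
  by rewrite !mulmxA -[_ *m U^T *m U]mulmxA oU mulmx1.
have : psd (U^T *m (T *m T - S *m S) *m U) by exact: psd_congruence.
have -> : T *m T - S *m S = U *m (T' *m diag_mx d) *m U^T
    + U *m (diag_mx d *m T') *m U^T - U *m (diag_mx d *m diag_mx d) *m U^T.
  rewrite -!UU -Tc ES mulmxBl !mulmxBr.
  move: (T *m T) (T *m _) (_ *m T) (_ *m _) => P1 P2 P3 P4.
  by apply/matrixP => j k; rewrite !mxE; ring.
rewrite -mulmxDl -mulmxBl -mulmxDr -mulmxBr conj_congruence //.
move=> /psd_diag_entry => /(_ i); have := psd_diag_entry i T'0.
rewrite mul_mx_diag mulmx_diag mul_diag_mx !mxE eqxx mulr1n.
move: (d 0 i) (T' i i); clear => x t t0 h.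
by rewrite leNgt; apply/negP => xneg; nra.
Qed.

(** Operator monotonicity, applied in both directions to two square roots of
    the same matrix. *)
Lemma sqrtmx_unique S B : psd S -> S *m S = B -> sqrtmx B = S.
Proof.
move=> pS SB; apply: xget_unique; first by split.
move=> T [pT TB]; apply/eqP; rewrite -subr_eq0; apply/eqP; apply: psd_anti.
  by apply: psd_sqrt_monotone => //; rewrite SB TB subrr; exact: psd0.
by rewrite opprB; apply: psd_sqrt_monotone => //; rewrite SB TB subrr; exact: psd0.
Qed.

Lemma sqrtmx_conj U d : orthogonal_mx U -> (forall i, 0 <= d 0 i) ->
  sqrtmx (U *m diag_mx d *m U^T) = U *m diag_mx (map_mx Num.sqrt d) *m U^T.
Proof.
move=> oU d0; apply: sqrtmx_unique.
  by apply/psd_conj/psd_diag_mx => i; rewrite mxE sqrtr_ge0.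
rewrite !mulmxA -[_ *m U^T *m U]mulmxA oU mulmx1 -[U *m _ *m diag_mx _]mulmxA.
rewrite mulmx_diag; congr (_ *m diag_mx _ *m _).
by apply/rowP => i; rewrite !mxE -expr2 sqr_sqrtr.
Qed.

Lemma sqrtmxP B : psd B -> psd (sqrtmx B) /\ sqrtmx B *m sqrtmx B = B.
Proof.
move=> /psd_spectral[U [d [oU d0 ->]]].
have pS : psd (U *m diag_mx (map_mx Num.sqrt d) *m U^T).
  by apply/psd_conj/psd_diag_mx => i; rewrite mxE sqrtr_ge0.
rewrite sqrtmx_conj //; split => //.
rewrite !mulmxA -[_ *m U^T *m U]mulmxA oU mulmx1 -[U *m _ *m diag_mx _]mulmxA.
rewrite mulmx_diag; congr (_ *m diag_mx _ *m _).
by apply/rowP => i; rewrite !mxE -expr2 sqr_sqrtr.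
Qed.

Lemma absmx_svd U V d : orthogonal_mx U -> orthogonal_mx V ->
  (forall i, 0 <= d 0 i) -> absmx (U *m diag_mx d *m V^T) = V *m diag_mx d *m V^T.
Proof.
move=> oU oV d0; apply: sqrtmx_unique; first by apply/psd_conj/psd_diag_mx.
rewrite !trmx_mul trmxK tr_diag_mx !mulmxA.
rewrite -[_ *m V^T *m V]mulmxA oV mulmx1.
by rewrite -[_ *m U^T *m U]mulmxA oU mulmx1.
Qed.

Lemma absmx_conj U d : orthogonal_mx U ->
  absmx (U *m diag_mx d *m U^T) = U *m diag_mx (map_mx Num.norm d) *m U^T.
Proof.
move=> oU; apply: sqrtmx_unique.
  by apply/psd_conj/psd_diag_mx => i; rewrite mxE normr_ge0.
rewrite !trmx_mul trmxK tr_diag_mx !mulmxA.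
rewrite -[_ *m U^T *m U]mulmxA oU mulmx1.
rewrite -[_ *m U^T *m U]mulmxA oU mulmx1.
rewrite -![U *m _ *m diag_mx _]mulmxA !mulmx_diag; congr (_ *m diag_mx _ *m _).
by apply/rowP => i; rewrite !mxE -normrM -expr2 ger0_norm ?sqr_ge0.
Qed.

Lemma pospart_conj U d : orthogonal_mx U ->
  pospart (U *m diag_mx d *m U^T) = U *m diag_mx (map_mx (fun x => Num.max x 0) d) *m U^T.
Proof.
move=> oU; rewrite /pospart absmx_conj // -mulmxDl -mulmxDr -linearD /=.
rewrite scalemxAl scalemxAr -linearZ /=; congr (_ *m diag_mx _ *m _).
apply/rowP => i; rewrite !mxE maxEle; case: ifP => [dn|/negbT]; last first.
  by rewrite -ltNge => /ltW dp; rewrite ger0_norm //; field.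
by rewrite ler0_norm // addNr mulr0.
Qed.

Lemma negpart_conj U d : orthogonal_mx U ->
  negpart (U *m diag_mx d *m U^T) = U *m diag_mx (map_mx (fun x => Num.max (- x) 0) d) *m U^T.
Proof.
move=> oU; rewrite /negpart absmx_conj // -mulmxBl -mulmxBr -linearB /=.
rewrite scalemxAl scalemxAr -linearZ /=; congr (_ *m diag_mx _ *m _).
apply/rowP => i; rewrite !mxE maxEle oppr_le0; case: ifP => [dn|/negbT].
  by rewrite ger0_norm // subrr mulr0.
by rewrite -ltNge => /ltW dp; rewrite ler0_norm //; field.
Qed.

Lemma psd_pospart A : A^T = A -> psd (pospart A).
Proof.
move=> /spectral[U [d [oU ->]]]; rewrite pospart_conj //.
by apply/psd_conj/psd_diag_mx => i; rewrite mxE le_max lexx orbT.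
Qed.

Lemma psd_negpart A : A^T = A -> psd (negpart A).
Proof.
move=> /spectral[U [d [oU ->]]]; rewrite negpart_conj //.
by apply/psd_conj/psd_diag_mx => i; rewrite mxE le_max lexx orbT.
Qed.

End PositiveSemidefinite.
(** * Perturbation of eigenvalues and singular values *)

Section Excess.
Context {R : realType}.

(** Comparing two rows by their excesses over all [t >= 0] amounts to weak
    majorization of their absolute values. *)
Definition excess m t (x : 'rV[R]_m) : R := \sum_i Num.max (`|x 0 i| - t) 0.

Lemma excess_perm m t (x : 'rV[R]_m) (s : 'S_m) : excess t (col_perm s x) = excess t x.
Proof.
rewrite /excess [RHS](reindex_inj (@perm_inj _ s)) /=.
by apply: eq_bigr => i _; rewrite mxE.
Qed.

Lemma excessN m t (x : 'rV[R]_m) : excess t (- x) = excess t x.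
Proof. by apply: eq_bigr => i _; rewrite mxE normrN. Qed.

Lemma excess_row_mx m1 m2 t (x : 'rV[R]_m1) (y : 'rV[R]_m2) :
  excess t (row_mx x y) = excess t x + excess t y.
Proof.
rewrite /excess big_split_ord /=; congr (_ + _); apply: eq_bigr => i _.
  by rewrite row_mxEl.
by rewrite row_mxEr.
Qed.

Lemma max_norm_split (h t : R) : 0 <= t ->
  Num.max (`|h| - t) 0 = Num.max (h - t) 0 + Num.max (- h - t) 0.
Proof.
move=> t0; have [h0|h0] := ger0P h.
  by rewrite [X in _ = _ + X]max_r ?addr0 //; lra.
by rewrite [X in _ = X + _]max_r ?add0r //; lra.
Qed.

End Excess.

Section Perturbation.
Context {R : realType}.

Lemma trace_conj m (U A : 'M[R]_m) : orthogonal_mx U -> \tr (U *m A *m U^T) = \tr A.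
Proof. by move=> oU; rewrite mxtrace_mulC mulmxA oU mul1mx. Qed.

Lemma dotv_diag_mx m (d : 'rV[R]_m) x :
  dotv x (diag_mx d *m x) = \sum_i d 0 i * x i 0 ^+ 2.
Proof.
rewrite dotvE; apply: eq_bigr => i _; rewrite mul_diag_mx mxE mulrCA; ring.
Qed.

Lemma dotvv m (x : 'cV[R]_m) : dotv x x = \sum_i x i 0 ^+ 2.
Proof. by rewrite dotvE; apply: eq_bigr => i _; rewrite expr2. Qed.

(** Courant-Fischer in its simplest form: some nonzero vector lies both in the
    span of the first [i + 1] eigenvectors of the smaller matrix, and in that
    of the eigenvectors of the larger one from the index [i] on. *)
Lemma eigenvalue_monotone m (U V : 'M[R]_m) a b :
  orthogonal_mx U -> orthogonal_mx V -> decreasing_row a -> decreasing_row b ->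
  psd (V *m diag_mx b *m V^T - U *m diag_mx a *m U^T) ->
  forall i, a 0 i <= b 0 i.
Proof.
move=> oU oV sa sb [_ ab0] i.
pose M := V^T *m U.
(* The vector [U c] is in both spans when [K c = 0]; the row [i] of [K] is
   zero, so [K] is singular. *)
pose K : 'M[R]_m := \matrix_(j, k)
  if (j < i)%N then M j k else if (i < j)%N then (k == j)%:R else 0.
have [c c0 Kc] : exists2 c : 'cV[R]_m, c != 0 & K *m c = 0.
  have : \det K^T = 0.
    rewrite det_tr (expand_det_row _ i) big1 // => j _.
    by rewrite mxE ltnn mul0r.
  move=> /eqP/det0P[w w0 wK]; exists w^T; first by rewrite trmx_eq0.
  by apply: trmx_inj; rewrite trmx_mul trmxK wK trmx0.
have chi (j : 'I_m) : (i < j)%N -> c j 0 = 0.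
  move=> ij; have /colP/(_ j) := Kc; rewrite !mxE => <-.
  rewrite (bigD1 j) //= big1 ?addr0 => [|k /negPf kj].
    by rewrite mxE ltnNge ltnW //= ij eqxx mul1r.
  by rewrite mxE ltnNge ltnW //= ij kj mul0r.
have Mlo (j : 'I_m) : (j < i)%N -> (M *m c) j 0 = 0.
  move=> ji; have /colP/(_ j) := Kc; rewrite [RHS]mxE => <-.
  by rewrite !mxE; apply: eq_bigr => k _; rewrite [K _ _]mxE ji.
have := ab0 (U *m c); rewrite mulmxBl dotvBr subr_ge0 -!mulmxA.
rewrite [U^T *m _]mulmxA oU mul1mx dotv_orthogonal // dotv_diag_mx.
rewrite [X in _ <= X]dotv_mulr ![V^T *m _]mulmxA -/M dotv_diag_mx => h.
have : a 0 i * dotv c c <= b 0 i * dotv c c.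
  apply: le_trans (le_trans h _).
    rewrite dotvv mulr_sumr; apply: ler_sum => j _.
    have [ij|ji] := ltnP i j; first by rewrite chi // expr0n !mulr0.
    by apply: ler_wpM2r; rewrite ?sqr_ge0 ?sa.
  have <- : dotv (M *m c) (M *m c) = dotv c c.
    by rewrite dotv_orthogonal //; apply: orthogonalM => //; apply: orthogonal_tr.
  rewrite dotvv mulr_sumr; apply: ler_sum => j _.
  have [ji|ij] := ltnP j i; first by rewrite Mlo // expr0n !mulr0.
  by apply: ler_wpM2r; rewrite ?sqr_ge0 ?sb.
by rewrite ler_pM2r // dotv_gt0.
Qed.

(** [c] lists the eigenvalues of an upper bound [C] of both [B] and [A - t],
    which is [B] plus the part of [A - B] that exceeds [t]. *)
Lemma eigenvalue_majorant m (U V W : 'M[R]_m) a b h t :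
  orthogonal_mx U -> orthogonal_mx V -> orthogonal_mx W ->
  decreasing_row a -> decreasing_row b ->
  U *m diag_mx a *m U^T - V *m diag_mx b *m V^T = W *m diag_mx h *m W^T ->
  exists c : 'rV[R]_m,
    [/\ forall i, a 0 i - t <= c 0 i, forall i, b 0 i <= c 0 i
      & \sum_i (c 0 i - b 0 i) = \sum_i Num.max (h 0 i - t) 0].
Proof.
move=> oU oV oW sa sb AB.
set A := U *m diag_mx a *m U^T in AB; set B := V *m diag_mx b *m V^T in AB.
pose e := map_mx (fun x => Num.max (x - t) 0) h.
pose C := B + W *m diag_mx e *m W^T.
have [|Q [c [oQ sc EC]]] := @spectral_sorted R m C.
  by rewrite linearD /= !trmx_mul !trmxK !tr_diag_mx !mulmxA.
exists c; split.
- move=> i; suff : a 0 i <= (c + const_mx t) 0 i by rewrite !mxE -lerBlDr.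
  apply: (eigenvalue_monotone oU oQ) => //.
    by move=> j k jk; rewrite !mxE lerD2r; exact: sc.
  rewrite linearD /= mulmxDr mulmxDl -EC diag_const_mx mul_mx_scalar -scalemxAl.
  rewrite orthogonal_mxV // -(orthogonal_mxV oW) scalemxAl -mul_mx_scalar.
  have -> : C + W *m t%:M *m W^T - A = W *m (diag_mx e + t%:M - diag_mx h) *m W^T.
    rewrite mulmxBr mulmxBl mulmxDr mulmxDl -AB /C.
    by rewrite opprB addrA addrAC [in RHS]addrC !addrA.
  rewrite -diag_const_mx -linearD -linearB /=.
  apply/psd_conj/psd_diag_mx => j; rewrite !mxE; move: (h 0 j); clear => y.
  have : y - t <= Num.max (y - t) 0 by rewrite le_max lexx.
  lra.
- apply: (eigenvalue_monotone oV oQ) => //; rewrite -EC /C addrC addKr.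
  by apply/psd_conj/psd_diag_mx => i; rewrite mxE le_max lexx orbT.
- rewrite big_split sumrN /= -!mxtrace_diag -(trace_conj _ oQ) -EC.
  rewrite -[\tr (diag_mx b)](trace_conj _ oV) -/B mxtraceD addrC addKr.
  by rewrite trace_conj // mxtrace_diag; apply: eq_bigr => i _; rewrite mxE.
Qed.

(** Lidskii's theorem, by the argument of Li and Mathias: [c] dominates [b] and
    [a - t], while [d] dominates [a] and [b - t], so that the excess of
    [|a_i - b_i|] is at most [(c_i - b_i) + (d_i - a_i)]; the sums of these
    nonnegative differences are traces of the two added parts. *)
Lemma eigenvalue_perturbation m (U V W : 'M[R]_m) a b h t :
  orthogonal_mx U -> orthogonal_mx V -> orthogonal_mx W ->
  decreasing_row a -> decreasing_row b ->
  U *m diag_mx a *m U^T - V *m diag_mx b *m V^T = W *m diag_mx h *m W^T ->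
  0 <= t -> excess t (a - b) <= excess t h.
Proof.
move=> oU oV oW sa sb AB t0.
have [c [ac bc sc]] := eigenvalue_majorant t oU oV oW sa sb AB.
have BA : V *m diag_mx b *m V^T - U *m diag_mx a *m U^T = W *m diag_mx (- h) *m W^T.
  by rewrite linearN /= mulmxN mulNmx -AB opprB.
have [d [bd ad sd]] := eigenvalue_majorant t oV oU oW sb sa BA.
apply: (@le_trans _ _ (\sum_i ((c 0 i - b 0 i) + (d 0 i - a 0 i)))).
  apply: ler_sum => i _; rewrite !mxE ge_max.
  have := ac i; have := bc i; have := bd i; have := ad i.
  move: (a 0 i) (b 0 i) (c 0 i) (d 0 i); clear => a b c d ad bd bc ac.
  apply/andP; split; last by lra.
  rewrite lerBlDr ler_norml; apply/andP; split; lra.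
rewrite big_split /= sc sd -big_split /= ler_sum // => i _.
by rewrite mxE max_norm_split.
Qed.

(** A symmetric matrix whose eigenvalues are the singular values of [X] and
    their opposites; it carries results on eigenvalues over to singular
    values. *)
Definition dilation m (X : 'M[R]_m) : 'M[R]_(m + m) := block_mx 0 X X^T 0.

(** The second half is reversed so that decreasing rows stay decreasing. *)
Definition symmetrize m (x : 'rV[R]_m) : 'rV[R]_(m + m) :=
  row_mx x (- col_perm (perm (@rev_ord_inj m)) x).

(** The eigenvectors are the columns [(u, v)] and [(u, - v)], divided by
    [sqrt 2], for the pairs [u], [v] of singular vectors. *)
Lemma dilation_spectral m (U V : 'M[R]_m) x :
  orthogonal_mx U -> orthogonal_mx V -> exists2 Q, orthogonal_mx Q &
  dilation (U *m diag_mx x *m V^T) = Q *m diag_mx (symmetrize x) *m Q^T.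
Proof.
move=> oU oV; pose P : 'M[R]_m := perm_mx (perm (@rev_ord_inj m)).
have oP : orthogonal_mx P by exact: orthogonal_perm.
pose r := Num.sqrt (2^-1 : R).
have rr : r * r = 2^-1 by rewrite -expr2 sqr_sqrtr // invr_ge0 ler0n.
have r2 p (M : 'M[R]_p) : r *: (r *: (M + M)) = M.
  by rewrite scalerA rr -mulr2n -scaler_nat scalerA mulVf ?scale1r // pnatr_eq0.
have tN (A : 'M[R]_m) : (- A)^T = - A^T by rewrite linearN.
exists (r *: block_mx U (U *m P^T) V (- (V *m P^T))).
  rewrite /orthogonal_mx [(_ *: _)^T]linearZ /= -scalemxAl -scalemxAr.
  rewrite tr_block_mx mulmx_block !tN !trmx_mul !trmxK !(mulmxN, mulNmx, opprK, mulmxA) oU oV.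
  rewrite -[P *m U^T *m U]mulmxA -[P *m V^T *m V]mulmxA oU oV !mul1mx !mulmx1.
  rewrite !subrr orthogonal_mxV // -[RHS](r2 (m + m)%N) [in RHS]scalar_mx_block.
  by rewrite add_block_mx !addr0.
rewrite /symmetrize diag_mx_row linearN /= diag_col_perm -/P.
rewrite [(_ *: _)^T]linearZ /= -!scalemxAl -scalemxAr tr_block_mx !mulmx_block.
rewrite -[LHS](r2 (m + m)%N) /dilation add_block_mx; congr (_ *: (_ *: _)).
rewrite !mulmx0 !addr0 !add0r !tN !trmx_mul !trmxK tr_diag_mx.
have PP n (A : 'M[R]_(n, m)) : A *m P^T *m P = A by rewrite -mulmxA oP mulmx1.
rewrite !(mulmxN, mulNmx, opprK, mulmxA, PP).
by rewrite !addrN.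
Qed.

Lemma decreasing_symmetrize m (x : 'rV[R]_m) :
  decreasing_row x -> (forall i, 0 <= x 0 i) -> decreasing_row (symmetrize x).
Proof.
move=> sx x0 i j; rewrite !mxE.
case: splitP => k ->; case: splitP => l ->; rewrite ?mxE ?permE.
- exact: sx.
- by move=> /(leq_trans (leq_addr l m)); rewrite leqNgt ltn_ord.
- by move=> _; apply: le_trans (x0 l); rewrite oppr_le0.
- by rewrite leq_add2l lerN2 => kl; apply: sx; rewrite leq_sub2l.
Qed.

Lemma excess_symmetrize m t (x : 'rV[R]_m) :
  excess t (symmetrize x) = excess t x + excess t x.
Proof. by rewrite excess_row_mx excessN excess_perm. Qed.

(** The eigenvalue bound for the dilations; each excess is counted twice on
    both sides. *)
Lemma singular_value_perturbation m (U1 V1 U2 V2 : 'M[R]_m) x y z X Y t :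
  orthogonal_mx U1 -> orthogonal_mx V1 -> orthogonal_mx U2 -> orthogonal_mx V2 ->
  decreasing_row x -> decreasing_row y ->
  (forall i, 0 <= x 0 i) -> (forall i, 0 <= y 0 i) ->
  X = U1 *m diag_mx x *m V1^T -> Y = U2 *m diag_mx y *m V2^T ->
  forall U3 V3, orthogonal_mx U3 -> orthogonal_mx V3 ->
  X - Y = U3 *m diag_mx z *m V3^T ->
  0 <= t -> excess t (x - y) <= excess t z.
Proof.
move=> oU1 oV1 oU2 oV2 sx sy x0 y0 EX EY U3 V3 oU3 oV3 EZ t0.
have [Q1 oQ1 E1] := dilation_spectral x oU1 oV1.
have [Q2 oQ2 E2] := dilation_spectral y oU2 oV2.
have [Q3 oQ3 E3] := dilation_spectral z oU3 oV3.
have : excess t (symmetrize x - symmetrize y) <= excess t (symmetrize z).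
  apply: (eigenvalue_perturbation oQ1 oQ2 oQ3) => //.
  - exact: decreasing_symmetrize.
  - exact: decreasing_symmetrize.
  - rewrite -E1 -E2 -E3 -EX -EY -EZ /dilation opp_block_mx add_block_mx.
    by rewrite !subr0 linearB.
have -> : symmetrize x - symmetrize y = symmetrize (x - y).
  rewrite /symmetrize opp_row_mx add_row_mx; congr row_mx.
  by apply/rowP => i; rewrite !mxE opprB opprK addrC.
by rewrite !excess_symmetrize; lra.
Qed.

End Perturbation.
(** * Orthogonally invariant norms *)

Section InvariantNorm.
Context {R : realType}.

(** The real counterpart of a unitarily invariant norm. *)
Record orthogonally_invariant_norm m (N : 'M[R]_m -> R) : Prop :=
  OrthogonallyInvariantNorm {
    oin_scale : forall a X, N (a *: X) = `|a| * N X;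
    oin_triangle : forall X Y, N (X + Y) <= N X + N Y;
    oin_orthogonal : forall U X V, orthogonal_mx U -> orthogonal_mx V ->
      N (U *m X *m V) = N X }.

Context {m : nat} {N : 'M[R]_m -> R} (hN : orthogonally_invariant_norm N).
Implicit Types (X Y S U V : 'M[R]_m) (x y d : 'rV[R]_m).

Lemma oin_opp X : N (- X) = N X.
Proof. by rewrite -scaleN1r (oin_scale hN) normrN1 mul1r. Qed.

Lemma oin_zero : N 0 = 0.
Proof. by rewrite -(scale0r (0 : 'M[R]_m)) (oin_scale hN) normr0 mul0r. Qed.

Lemma oin_mull U X : orthogonal_mx U -> N (U *m X) = N X.
Proof.
by move=> oU; rewrite -[U *m X]mulmx1 (oin_orthogonal hN) //; exact: orthogonal1.
Qed.

Lemma oin_mulr X V : orthogonal_mx V -> N (X *m V) = N X.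
Proof.
by move=> oV; rewrite -[X]mul1mx (oin_orthogonal hN) ?mul1mx //; exact: orthogonal1.
Qed.

Lemma oin_svd U V d : orthogonal_mx U -> orthogonal_mx V ->
  N (U *m diag_mx d *m V^T) = N (diag_mx d).
Proof. by move=> oU oV; rewrite (oin_orthogonal hN) //; apply: orthogonal_tr. Qed.

Lemma oin_col_perm (s : 'S_m) d : N (diag_mx (col_perm s d)) = N (diag_mx d).
Proof. by rewrite diag_col_perm oin_svd //; exact: orthogonal_perm. Qed.

Lemma oin_convex X Y a b : 0 <= a -> 0 <= b -> a + b = 1 -> N Y <= N X ->
  N (a *: X + b *: Y) <= N X.
Proof.
move=> a0 b0 ab YX; apply: le_trans (oin_triangle hN _ _) _.
rewrite !(oin_scale hN) !ger0_norm // -[leRHS]mul1r -ab mulrDl lerD2l.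
exact: ler_wpM2l.
Qed.

(** A diagonal contraction is a convex combination of diagonal sign matrices;
    its entries are introduced one at a time. *)
Lemma oin_diag_contraction d X :
  (forall i, `|d 0 i| <= 1) -> N (diag_mx d *m X) <= N X.
Proof.
move=> d1.
pose e k : 'rV[R]_m := \row_i if (i < k)%N then d 0 i else 1.
have -> : d = e m by apply/rowP => i; rewrite mxE ltn_ord.
suff H k : (k <= m)%N -> N (diag_mx (e k) *m X) <= N X by exact: H.
elim: k => [_|k IH km].
  rewrite (_ : diag_mx _ = 1%:M) ?mul1mx //.
  by rewrite -diag_const_mx; congr diag_mx; apply/rowP => i; rewrite !mxE.
pose j := Ordinal km.
(* With [s] the sign change at [j], the entry [d j] in [-1, 1] is the average of
   [1] and [-1] with weights [(1 + d j) / 2] and [(1 - d j) / 2]. *)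
pose s : 'rV[R]_m := \row_i (-1) ^+ (i == j).
have os : orthogonal_mx (diag_mx s) by exact: orthogonal_sign.
apply: le_trans (IH (ltnW km)).
have -> : diag_mx (e k.+1) *m X = ((1 + d 0 j) / 2) *: (diag_mx (e k) *m X)
    + ((1 - d 0 j) / 2) *: (diag_mx s *m (diag_mx (e k) *m X)).
  rewrite !mul_diag_mx; apply/matrixP => a b; rewrite !mxE ltnS leq_eqVlt.
  have [->|aj] := eqVneq a j; first by rewrite eqxx ltnn /=; field.
  have -> : (a == k :> nat) = false by apply/negP => ak; case/negP: aj.
  by rewrite /=; field.
have := d1 j; rewrite ler_norml => /andP[dl du].
apply: oin_convex; rewrite ?(oin_mull _ os) //.
- by rewrite divr_ge0 ?ler0n // -lerBlDl sub0r.
- by rewrite divr_ge0 ?ler0n // subr_ge0.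
- by field.
Qed.

Lemma oin_diag_bound d c X :
  (forall i, `|d 0 i| <= c) -> 0 <= c -> N (diag_mx d *m X) <= c * N X.
Proof.
move=> dc; rewrite le_eqVlt => /predU1P[c0|c0].
  rewrite -c0 mul0r (_ : diag_mx d = 0) ?mul0mx ?oin_zero //.
  apply/matrixP => i j; rewrite !mxE; have := dc i; rewrite -c0 normr_le0 => /eqP->.
  by rewrite mul0rn.
have -> : diag_mx d *m X = c *: (diag_mx (c^-1 *: d) *m X).
  by rewrite linearZ /= -scalemxAl scalerA divff ?scale1r // gt_eqF.
rewrite (oin_scale hN) gtr0_norm // ler_pM2l //.
apply: oin_diag_contraction => i; rewrite mxE normrM gtr0_norm ?invr_gt0 //.
by rewrite ler_pdivrMl // mulr1.
Qed.

Lemma oin_diag_mono x y :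
  (forall i, `|x 0 i| <= `|y 0 i|) -> N (diag_mx x) <= N (diag_mx y).
Proof.
move=> xy; have -> : diag_mx x = diag_mx (\row_i (x 0 i / y 0 i)) *m diag_mx y.
  rewrite mulmx_diag; congr diag_mx; apply/rowP => i; rewrite !mxE.
  have := xy i; have [->|y0] := eqVneq (y 0 i) 0; last by rewrite divfK.
  by rewrite normr0 normr_le0 mulr0 => /eqP.
apply: oin_diag_contraction => i; rewrite mxE normrM normfV.
have := xy i; have [->|y0] := eqVneq (y 0 i) 0; first by rewrite normr0 invr0 mulr0.
by rewrite ler_pdivrMr ?normr_gt0 // mul1r.
Qed.

(** A step of the Hardy-Littlewood-Polya argument: [y] is replaced by an
    average of [y] and of [y] with two entries exchanged, which makes one more
    entry of [y] equal to that of [x] and keeps the partial sums above. *)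
Lemma transfer_step x y (i j : 'I_m) :
  decreasing_row x ->
  (forall k, \sum_(l < m | (l < k)%N) x 0 l <= \sum_(l < m | (l < k)%N) y 0 l) ->
  (i < j)%N -> x 0 i < y 0 i -> y 0 j < x 0 j ->
  (forall l : 'I_m, (l < j)%N -> x 0 l <= y 0 l) ->
  exists z,
    [/\ N (diag_mx z) <= N (diag_mx y),
        forall k, \sum_(l < m | (l < k)%N) x 0 l <= \sum_(l < m | (l < k)%N) z 0 l
      & (#|[set l | (x 0 l != z 0 l)%R]| < #|[set l | (x 0 l != y 0 l)%R]|)%N].
Proof.
move=> sx xy ij xyi xyj xyl.
have nij : i != j by apply: contraTN ij => /eqP->; rewrite ltnn.
have xij : x 0 j <= x 0 i by apply: sx; exact: ltnW.
pose dl := Num.min (y 0 i - x 0 i) (x 0 j - y 0 j).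
have dl0 : 0 < dl by rewrite lt_min !subr_gt0 xyi xyj.
have dli : dl <= y 0 i - x 0 i by rewrite ge_min lexx.
have dlj : dl <= x 0 j - y 0 j by rewrite ge_min lexx orbT.
pose z : 'rV[R]_m := \row_l (y 0 l - dl * (l == i)%:R + dl * (l == j)%:R).
have zE l : z 0 l = y 0 l - dl * (l == i)%:R + dl * (l == j)%:R by rewrite mxE.
exists z; split.
- pose g := y 0 i - y 0 j; have g0 : 0 < g by rewrite /g; lra.
  have -> : diag_mx z = (1 - dl / g) *: diag_mx y
                        + (dl / g) *: diag_mx (col_perm (tperm i j) y).
    rewrite -!linearZ -linearD /=; congr diag_mx; apply/rowP => l.
    rewrite zE !mxE.
    have key : dl = dl / g * y 0 i - dl / g * y 0 j by rewrite -mulrBr divfK ?gt_eqF.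
    have [->|li] := eqVneq l i.
      by rewrite (negPf nij) tpermL mulr1 mulr0 addr0 [X in _ - X]key; ring.
    have [->|lj] := eqVneq l j.
      by rewrite tpermR mulr1 mulr0 subr0 [X in _ + X = _]key; ring.
    by rewrite tpermD 1?eq_sym // !mulr0 subr0 addr0; ring.
  apply: oin_convex; rewrite ?oin_col_perm ?subrK //.
    by rewrite subr_ge0 ler_pdivrMr // mul1r /g; lra.
  by rewrite divr_ge0 // ltW.
- move=> k; under [X in _ <= X]eq_bigr do rewrite zE.
  rewrite big_split big_split /= sumrN -!mulr_sumr.
  have ind (l : 'I_m) : \sum_(l' < m | (l' < k)%N) (l' == l)%:R = (l < k)%N%:R :> R.
    rewrite big_mkcond (bigD1 l) //= big1 ?addr0 => [|l' /negPf ->]; last by case: ifP.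
    by rewrite eqxx; case: ifP.
  rewrite !ind; have [jk|kj] := ltnP j k.
    by rewrite (ltn_trans ij jk) !mulr1 subrK xy.
  rewrite mulr0 addr0; have [ik|ki] := ltnP i k; last by rewrite mulr0 subr0 xy.
  rewrite mulr1 lerBrDr -lerBrDl -sumrB (bigD1 i) //=.
  rewrite -[leLHS]addr0; apply: lerD => //; apply: sumr_ge0 => l /andP[lk _].
  by rewrite subr_ge0 xyl // (leq_trans lk).
- apply: proper_card; apply/properP; split.
    apply/fintype.subsetP => l; rewrite !inE; apply: contra => /eqP xyl'; rewrite zE.
    have li : l != i by apply: contraTneq xyi => <-; rewrite xyl' ltxx.
    have lj : l != j by apply: contraTneq xyj => <-; rewrite xyl' ltxx.
    by rewrite (negPf li) (negPf lj) !mulr0 subr0 addr0 xyl'.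
  have [h|h] := leP (y 0 i - x 0 i) (x 0 j - y 0 j).
    exists i; rewrite inE; first by rewrite lt_eqF.
    by rewrite zE eqxx (negPf nij) /dl min_l // negbK mulr1 mulr0; apply/eqP; ring.
  exists j; rewrite inE; first by rewrite gt_eqF.
  rewrite zE eqxx [j == i]eq_sym (negPf nij) /dl min_r ?ltW //.
  by rewrite negbK mulr1 mulr0; apply/eqP; ring.
Qed.

(** Induction on the number of places where [x] and [y] differ.  If [y] does not
    dominate [x], let [j] be the first place with [y_j < x_j]; comparing the
    partial sums up to [j] gives an earlier place [i] with [x_i < y_i], and
    [transfer_step] moves some weight of [y] from [i] to [j]. *)
Lemma weak_majorization x y :
  decreasing_row x -> (forall i, 0 <= x 0 i) ->
  (forall k, \sum_(l < m | (l < k)%N) x 0 l <= \sum_(l < m | (l < k)%N) y 0 l) ->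
  N (diag_mx x) <= N (diag_mx y).
Proof.
move=> sx x0.
have [c] := ubnP #|[set l | x 0 l != y 0 l]|; elim: c y => // c IH y cy xy.
have [le_xy|/existsNP[j0 /negP j0P]] := pselect (forall i, x 0 i <= y 0 i).
  apply: oin_diag_mono => i; rewrite !ger0_norm //; exact: le_trans (le_xy i).
rewrite -ltNge in j0P.
have [j xyj jmin] := @arg_minnP _ j0 (fun l => y 0 l < x 0 l) val j0P.
have xyl (l : 'I_m) : (l < j)%N -> x 0 l <= y 0 l.
  by move=> lj; rewrite leNgt; apply/negP => /jmin; rewrite leqNgt lj.
have [i ij xyi] : exists2 i : 'I_m, (i < j)%N & x 0 i < y 0 i.
  apply: contrapT => no.
  have eqxy (l : 'I_m) : (l < j)%N -> x 0 l = y 0 l.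
    move=> lj; apply/le_anti; rewrite xyl //= leNgt; apply/negP => h.
    by apply: no; exists l.
  have split_j (w : 'rV[R]_m) : \sum_(l < m | (l < j.+1)%N) w 0 l
      = w 0 j + \sum_(l < m | (l < j)%N) w 0 l.
    rewrite (bigD1 j) //=; congr (_ + _); apply: eq_bigl => l.
    by rewrite ltnS ltn_neqAle andbC.
  have := xy j.+1; rewrite !split_j (eq_bigr _ eqxy) lerD2r.
  by rewrite leNgt xyj.
have [z [zy xz cz]] := transfer_step sx xy ij xyi xyj xyl.
by apply: le_trans (IH z _ xz) zy; rewrite -ltnS (leq_trans _ cy) // ltnS.
Qed.

(** Fan dominance, in terms of [excess]: the partial sum of the [k] largest
    entries of [x] is at most [k t + excess t x], with equality for [y] when
    [t] is its [k]-th entry. *)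
Lemma fan_dominance x y :
  (forall t, 0 <= t -> excess t x <= excess t y) -> N (diag_mx x) <= N (diag_mx y).
Proof.
move=> xy.
have norm_sort (w : 'rV[R]_m) : exists v : 'rV[R]_m,
    [/\ decreasing_row v, forall i, 0 <= v 0 i, N (diag_mx v) = N (diag_mx w)
      & forall t, excess t v = excess t w].
  have [s ss] := exists_sorting_perm (map_mx Num.norm w).
  exists (col_perm s (map_mx Num.norm w)); split => //.
  - by move=> i; rewrite !mxE.
  - rewrite oin_col_perm; apply/le_anti.
    by rewrite !oin_diag_mono // => i; rewrite mxE normr_id.
  - by move=> t; rewrite excess_perm; apply: eq_bigr => i _; rewrite mxE normr_id.
have [x' [sx x0 <- ex]] := norm_sort x; have [y' [sy y0 <- ey]] := norm_sort y.
apply: weak_majorization => // -[|k]; first by rewrite !big_pred0.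
have [mk|km] := leqP m k.
  have allk (w : 'rV[R]_m) : (forall i, 0 <= w 0 i) ->
      \sum_(l < m | (l < k.+1)%N) w 0 l = excess 0 w.
    move=> w0; rewrite /excess; apply: eq_big => [l|l _].
      by rewrite (leq_trans (ltn_ord l)) // ltnW.
    by rewrite subr0 ger0_norm // max_l.
  by rewrite !allk // ex ey xy.
pose t := y' 0 (Ordinal km).
have -> : \sum_(l < m | (l < k.+1)%N) y' 0 l
    = \sum_(l < m | (l < k.+1)%N) t + excess t y'.
  rewrite /excess [X in _ + X]big_mkcond [X in _ + X](bigID (fun l : 'I_m => (l < k.+1)%N)) /=.
  rewrite [X in _ + (_ + X)]big1 ?addr0; last first.
    move=> l; rewrite -leqNgt => kl; rewrite ger0_norm // max_r // subr_le0.
    by apply: sy; rewrite /= ltnW.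
  rewrite -big_split /=; apply: eq_bigr => l lk.
  rewrite ger0_norm // max_l; first by rewrite addrC subrK.
  by rewrite subr_ge0; apply: sy.
apply: le_trans (_ : \sum_(l < m | (l < k.+1)%N) t + excess t x' <= _); last first.
  by rewrite lerD2l ex ey xy // /t.
rewrite /excess [X in _ + X](bigID (fun l : 'I_m => (l < k.+1)%N)) /= addrA -big_split /=.
rewrite -[leLHS]addr0; apply: lerD; last by apply: sumr_ge0 => l _; rewrite le_max lexx orbT.
apply: ler_sum => l _; rewrite -lerBlDl ger0_norm //.
by rewrite le_max lexx.
Qed.

End InvariantNorm.

Section Mirsky.
Context {R : realType} {m : nat} {N : 'M[R]_m -> R}.
Hypothesis hN : orthogonally_invariant_norm N.
Implicit Types X Y : 'M[R]_m.

Lemma eigvals_absmx X : exists U V, [/\ orthogonal_mx U, orthogonal_mx V,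
  decreasing_row (eigvals (absmx X)), forall i, 0 <= eigvals (absmx X) 0 i
  & X = U *m diag_mx (eigvals (absmx X)) *m V^T].
Proof.
have [U [V [d [oU oV d0 sd EX]]]] := singular_value_decomposition_sorted X.
have -> : eigvals (absmx X) = d by rewrite EX absmx_svd // eigvals_conj.
by exists U, V.
Qed.

Lemma mirsky X Y : N (Eig (absmx X) - Eig (absmx Y)) <= N (X - Y).
Proof.
have [U1 [V1 [oU1 oV1 sx x0 EX]]] := eigvals_absmx X.
have [U2 [V2 [oU2 oV2 sy y0 EY]]] := eigvals_absmx Y.
have [U3 [V3 [z [oU3 oV3 _ EZ]]]] := singular_value_decomposition (X - Y).
rewrite EZ (oin_svd hN) // /Eig -linearB /=; apply: fan_dominance => // t t0.
exact: (singular_value_perturbation oU1 oV1 oU2 oV2 sx sy x0 y0 EX EY oU3 oV3 EZ t0).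
Qed.

(** Changing the sign reverses the order. *)
Lemma eigvals_opp_absmx X :
  eigvals (- absmx X) = - col_perm (perm (@rev_ord_inj m)) (eigvals (absmx X)).
Proof.
have [U [V [oU oV sx x0 EX]]] := eigvals_absmx X.
move: (eigvals _) sx x0 EX => x sx x0 EX; set s := perm _.
rewrite EX absmx_svd //; pose P : 'M[R]_m := perm_mx s.
have oP : orthogonal_mx P by exact: orthogonal_perm.
have -> : - (V *m diag_mx x *m V^T)
    = (V *m P^T) *m diag_mx (- col_perm s x) *m (V *m P^T)^T.
  rewrite linearN /= diag_col_perm -/P mulmxN mulNmx; congr (- _).
  rewrite trmx_mul trmxK !mulmxA -[V *m P^T *m P]mulmxA oP mulmx1.
  by rewrite -[_ *m P^T *m P]mulmxA oP mulmx1.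
apply: eigvals_conj; first by apply: orthogonalM => //; apply: orthogonal_tr.
by move=> i j ij; rewrite !mxE !permE lerN2; apply: sx; rewrite /= leq_sub2l.
Qed.

Lemma mirsky_opp X Y : N (Eig (- absmx X) - Eig (- absmx Y)) <= N (X - Y).
Proof.
apply: le_trans (mirsky X Y); rewrite /Eig !eigvals_opp_absmx -!linearB /=.
set s := perm _; rewrite le_eqVlt; apply/predU1P; left.
rewrite -(oin_col_perm hN s) -(oin_opp hN) -linearN /=; congr (N (diag_mx _)).
by apply/rowP => i; rewrite !mxE /s !permE !rev_ordK; ring.
Qed.

End Mirsky.
(** * Perturbation of the square root *)

Section SquareRoot.
Context {R : realType}.

Lemma orthogonal_diag_entry m (U : 'M[R]_m) i : orthogonal_mx U -> U i i <= 1.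
Proof.
move=> /matrixP/(_ i i); rewrite !mxE eqxx => h.
have : U i i ^+ 2 <= 1.
  rewrite -[leRHS]/(true%:R) -h (bigD1 i) //= mxE -expr2 lerDl.
  by apply: sumr_ge0 => k _; rewrite mxE -expr2 sqr_ge0.
move=> h1; rewrite leNgt; apply/negP => h2; move: h1.
by rewrite leNgt exprn_egt1.
Qed.

(** The trace of the absolute value is the nuclear norm; it is the largest
    value of [\tr (O *m X)] over the orthogonal [O], hence subadditive. *)
Lemma trace_le_trace_absmx m (O X : 'M[R]_m) :
  orthogonal_mx O -> \tr (O *m X) <= \tr (absmx X).
Proof.
move=> oO; have [U [V [x [oU oV x0 ->]]]] := singular_value_decomposition X.
rewrite absmx_svd // trace_conj // mxtrace_diag.
rewrite !mulmxA mxtrace_mulC !mulmxA.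
have : orthogonal_mx (V^T *m O *m U).
  by apply: orthogonalM => //; apply: orthogonalM => //; apply: orthogonal_tr.
move: (V^T *m O *m U) => P oP; rewrite /mxtrace; apply: ler_sum => i _.
rewrite mul_mx_diag mxE -[leRHS]mul1r ler_wpM2r //.
exact: orthogonal_diag_entry.
Qed.

Lemma trace_absmxD m (X Y : 'M[R]_m) :
  \tr (absmx (X + Y)) <= \tr (absmx X) + \tr (absmx Y).
Proof.
have [U [V [s [oU oV s0 E]]]] := singular_value_decomposition (X + Y).
have oO : orthogonal_mx (V *m U^T) by apply: orthogonalM => //; apply: orthogonal_tr.
have -> : \tr (absmx (X + Y)) = \tr (V *m U^T *m (X + Y)).
  by rewrite E absmx_svd // !mulmxA -[V *m U^T *m U]mulmxA oU mulmx1.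
by rewrite mulmxDr mxtraceD lerD // trace_le_trace_absmx.
Qed.

Lemma sqrtmx_block0 m (B : 'M[R]_m) :
  psd B -> sqrtmx (block_mx B 0 0 0 : 'M_(m + m)) = block_mx (sqrtmx B) 0 0 0.
Proof.
move=> pB; have [pS SS] := sqrtmxP pB; apply: sqrtmx_unique.
  have -> : block_mx (sqrtmx B) 0 0 0
      = (row_mx 1%:M 0)^T *m sqrtmx B *m row_mx 1%:M 0 :> 'M_(m + m).
    rewrite tr_row_mx trmx1 trmx0 mul_col_mx mul_col_row.
    by rewrite !mul1mx !mul0mx mulmx1 mulmx0.
  exact: psd_congruence.
by rewrite mulmx_block !mulmx0 !mul0mx !addr0 SS.
Qed.

(** The square root of [S^T S + K^T K] is the absolute value of the column of
    blocks [S], [K]; the nuclear norm of that column is subadditive in [K]. *)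
Lemma trace_sqrtmx_column m (S K L : 'M[R]_m) :
  \tr (sqrtmx (S^T *m S + (K + L)^T *m (K + L)))
  <= \tr (sqrtmx (S^T *m S + K^T *m K)) + \tr (absmx L).
Proof.
have col_abs (A B : 'M[R]_m) :
    \tr (absmx (block_mx A 0 B 0)) = \tr (sqrtmx (A^T *m A + B^T *m B)).
  rewrite /absmx tr_block_mx mulmx_block !trmx0 !mulmx0 !mul0mx !addr0.
  by rewrite sqrtmx_block0 ?mxtrace_block ?mxtrace0 ?addr0 //; apply: psdD; exact: psd_gram.
have -> : \tr (absmx L) = \tr (absmx (block_mx 0 0 L 0)).
  by rewrite col_abs mulmx0 add0r.
rewrite -!col_abs.
apply: le_trans (trace_absmxD _ _).
by rewrite add_block_mx !addr0.
Qed.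

(** The square root of [T^2 + K^2] differs from [T] by a matrix between [0] and
    [t] up to a positive matrix of trace at most [\tr (K - t)_+]: the square root of
    [T^2 + min(K, t)^2] lies between them. *)
Lemma sqrt_increment m (S T W : 'M[R]_m) (k : 'rV[R]_m) (t : R) :
  psd S -> psd T -> orthogonal_mx W -> (forall i, 0 <= k 0 i) -> 0 <= t ->
  S *m S = T *m T + W *m diag_mx (map_mx (fun x => x ^+ 2) k) *m W^T ->
  exists E F, [/\ S - T = E + F, psd E, psd F, psd (t%:M - F)
    & \tr E <= \sum_i Num.max (k 0 i - t) 0].
Proof.
move=> pS pT oW k0 t0 SS.
pose k1 := map_mx (fun x => Num.min x t) k.
pose k2 := map_mx (fun x => Num.max (x - t) 0) k.
have k12 : k = k1 + k2.
  by apply/rowP => i; rewrite !mxE; case: lerP => h; case: lerP; lra.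
have k1ge0 i : 0 <= k1 0 i by rewrite mxE le_min k0.
have k1k i : k1 0 i <= k 0 i by rewrite mxE ge_min lexx.
have k1t i : k1 0 i <= t by rewrite mxE ge_min lexx orbT.
have k2ge0 i : 0 <= k2 0 i by rewrite mxE le_max lexx orbT.
pose cj (d : 'rV[R]_m) := W *m diag_mx d *m W^T.
have cjT d : (cj d)^T = cj d by rewrite /cj !trmx_mul trmxK tr_diag_mx mulmxA.
have cjM d e : cj d *m cj e = cj (\row_i (d 0 i * e 0 i)).
  by rewrite /cj !mulmxA -[_ *m W^T *m W]mulmxA oW mulmx1 -[W *m _ *m _]mulmxA mulmx_diag.
have cjB d e : cj d - cj e = cj (d - e).
  by rewrite /cj linearB /= mulmxBr mulmxBl.
have cjD d e : cj d + cj e = cj (d + e).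
  by rewrite /cj linearD /= mulmxDr mulmxDl.
have pcj (d : 'rV[R]_m) : (forall i, 0 <= d 0 i) -> psd (cj d).
  by move=> d0; apply/psd_conj/psd_diag_mx.
have cjt : (t ^+ 2)%:M = cj (const_mx (t ^+ 2)).
  by rewrite /cj diag_const_mx mul_mx_scalar -scalemxAl orthogonal_mxV // scalemx1.
have SSk : S *m S = T *m T + cj k *m cj k.
  by rewrite SS cjM; congr (_ + cj _); apply/rowP => i; rewrite !mxE expr2.
have pA : psd (T *m T + cj k1 *m cj k1).
  by apply: psdD; apply: psd_sqr => //; exact: pcj.
have [pS' SS'] := sqrtmxP pA; set S' := sqrtmx _ in pS' SS'.
exists (S - S'), (S' - T); split.
- by rewrite addrA subrK.
- apply: psd_sqrt_monotone => //; rewrite SSk SS' opprD addrACA subrr add0r.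
  rewrite !cjM cjB; apply: pcj => i; rewrite !mxE subr_ge0.
  by apply: ler_pM; rewrite ?le_min ?ge_min ?k0 ?t0 ?lexx.
- by apply: psd_sqrt_monotone => //; rewrite SS' addrC addKr; apply/psd_sqr/pcj.
- have -> : t%:M - (S' - T) = (T + t%:M) - S' by rewrite opprB addrA [t%:M + _]addrC.
  apply: psd_sqrt_monotone => //; first by apply: psdD => //; exact: psd_scalar.
  have -> : (T + t%:M) *m (T + t%:M) - S' *m S'
      = (2 * t) *: T + ((t ^+ 2)%:M - cj k1 *m cj k1).
    rewrite SS' mulmxDl !mulmxDr -scalar_mxM mul_mx_scalar mul_scalar_mx expr2.
    move: (T *m T) (_ *m _) (t * t)%:M => A B C.
    by apply/matrixP => i j; rewrite !mxE; ring.
  apply: psdD; first by apply: psdZ => //; rewrite mulr_ge0.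
  rewrite cjt cjM cjB; apply: pcj => i.
  by rewrite !mxE subr_ge0 expr2 ler_pM // ?le_min ?ge_min ?k0 ?t0 ?lexx ?orbT.
- rewrite linearB /= lerBlDl.
  have -> : \sum_i Num.max (k 0 i - t) 0 = \tr (absmx (cj k2)).
    rewrite absmx_svd // trace_conj // mxtrace_diag.
    by apply: eq_bigr => i _; rewrite mxE.
  have -> : S = sqrtmx (T^T *m T + (cj k1 + cj k2)^T *m (cj k1 + cj k2)).
    by rewrite pT.1 cjD cjT -k12 (sqrtmx_unique pS).
  have -> : S' = sqrtmx (T^T *m T + (cj k1)^T *m cj k1) by rewrite pT.1 cjT.
  exact: trace_sqrtmx_column.
Qed.

Context {m : nat} {N : 'M[R]_m -> R} (hN : orthogonally_invariant_norm N).

(** The upper bound [P + (P - Q)_- = Q + (P - Q)_+] of [P] and [Q], with square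
    root [C], reduces the comparison to two increments:
    [sqrt P - sqrt Q = (C - sqrt Q) - (C - sqrt P)].  By [sqrt_increment] each
    increment is between [0] and [t] up to a positive matrix of small trace.
    The two operator norm parts have opposite signs, so their difference is
    still between [- t] and [t], and the two traces add up to the excess of
    [sqrt |P - Q|] because its positive and negative parts have disjoint
    supports. *)
Lemma sqrtmx_perturbation (P Q : 'M[R]_m) : psd P -> psd Q ->
  N (sqrtmx P - sqrtmx Q) <= N (sqrtmx (absmx (P - Q))).
Proof.
move=> pP pQ; have [pS SS] := sqrtmxP pP; have [pT TT] := sqrtmxP pQ.
move: (sqrtmx P) (sqrtmx Q) pS SS pT TT => S T pS SS pT TT.
have [|W [h [oW EW]]] := @spectral R m (P - Q); first by rewrite linearB /= pP.1 pQ.1.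
rewrite EW absmx_conj // sqrtmx_conj; [|done|by move=> i; rewrite mxE].
rewrite (oin_svd hN) //.
have [|U [d [oU EU]]] := @spectral R m (S - T); first by rewrite linearB /= pS.1 pT.1.
rewrite EU (oin_svd hN) //; apply: fan_dominance => // t t0.
pose kp := map_mx (fun x => Num.sqrt (Num.max x 0)) h.
pose kn := map_mx (fun x => Num.sqrt (Num.max (- x) 0)) h.
pose sq (k : 'rV[R]_m) := W *m diag_mx (map_mx (fun x => x ^+ 2) k) *m W^T.
have psq (k : 'rV[R]_m) : psd (sq k) by apply/psd_conj/psd_diag_mx => i; rewrite mxE sqr_ge0.
have [pC CC] := sqrtmxP (psdD pQ (psq kp)).
move: (sqrtmx _) pC CC => C pC CC.
have CC' : C *m C = P + sq kn.
  rewrite CC; apply/eqP; rewrite -subr_eq0 opprD addrACA -opprB EW addrC.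
  rewrite -mulmxBl -mulmxBr -mulmxBl -mulmxBr -!linearB /=.
  apply/eqP; rewrite (_ : _ - _ - h = 0) ?linear0 ?mulmx0 ?mul0mx //.
  apply/rowP => i; rewrite !mxE !sqr_sqrtr ?le_max ?lexx ?orbT //.
  by move: (h 0 i); clear => x; case: lerP => h1; case: lerP => h2; lra.
have kp0 i : 0 <= kp 0 i by rewrite mxE sqrtr_ge0.
have kn0 i : 0 <= kn 0 i by rewrite mxE sqrtr_ge0.
have [|E1 [F1 [EF1 pE1 pF1 pt1 trE1]]] := @sqrt_increment m C T W kp t pC pT oW kp0 t0.
  by rewrite CC TT.
have [|E2 [F2 [EF2 pE2 pF2 pt2 trE2]]] := @sqrt_increment m C S W kn t pC pS oW kn0 t0.
  by rewrite CC' SS.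
have Ed : diag_mx d = U^T *m (E1 + F1 - (E2 + F2)) *m U.
  have -> : E1 + F1 - (E2 + F2) = S - T.
    by rewrite -EF1 -EF2 opprB addrC addrA subrK.
  by rewrite EU conj_congruence.
(* The diagonal of [X] in an eigenbasis of [sqrt P - sqrt Q]. *)
pose e X i := (U^T *m X *m U) i i.
have e0 X i : psd X -> 0 <= e X i.
  by move=> pX; apply: psd_diag_entry; exact: psd_congruence.
have eB X Y i : e (X - Y) i = e X i - e Y i by rewrite /e mulmxBr mulmxBl !mxE.
have eD X Y i : e (X + Y) i = e X i + e Y i by rewrite /e mulmxDr mulmxDl !mxE.
have et i : e t%:M i = t.
  by rewrite /e mul_mx_scalar -scalemxAl oU !mxE eqxx mulr1.
have etr X : \sum_i e X i = \tr X.
  by rewrite -[RHS](trace_conj _ (orthogonal_tr oU)) trmxK.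
have de i : d 0 i = e E1 i + e F1 i - (e E2 i + e F2 i).
  by rewrite -!eD -eB /e -Ed mxE eqxx mulr1n.
apply: (@le_trans _ _ (\tr E1 + \tr E2)).
  rewrite -!etr -big_split /=; apply: ler_sum => i _; rewrite de ge_max.
  have := e0 _ i pE1; have := e0 _ i pF1; have := e0 _ i pE2; have := e0 _ i pF2.
  have := e0 _ i pt1; have := e0 _ i pt2; rewrite !eB et.
  move: (e E1 i) (e F1 i) (e E2 i) (e F2 i) t0; clear => a b c d t0 *.
  apply/andP; split; last by lra.
  by rewrite lerBlDr ler_norml; apply/andP; split; lra.
apply: le_trans (lerD trE1 trE2) _; rewrite -big_split /= ler_sum // => i _.
rewrite !mxE; move: (h 0 i) => x; rewrite [`|Num.sqrt _|]ger0_norm ?sqrtr_ge0 //.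
have [x0|x0] := ger0P x.
  rewrite [Num.max (- x) 0]max_r ?oppr_le0 // sqrtr0 sub0r.
  by rewrite [Num.max (- t) 0]max_r ?oppr_le0 ?addr0.
rewrite sqrtr0 sub0r [Num.max (- t) 0]max_r ?oppr_le0 ?add0r //.
by rewrite [Num.max (- x) 0]max_l // oppr_ge0 ltW.
Qed.

End SquareRoot.
(** * The operator norm and the Frobenius norm *)

Section Norms.
Context {R : realType}.

Lemma minkowski_l2 (I : finType) (f g : I -> R) :
  Num.sqrt (\sum_i (f i + g i) ^+ 2)
  <= Num.sqrt (\sum_i f i ^+ 2) + Num.sqrt (\sum_i g i ^+ 2).
Proof.
set a := \sum_i f i ^+ 2; set b := \sum_i g i ^+ 2; pose c := \sum_i f i * g i.
have a0 : 0 <= a by apply: sumr_ge0 => i _; rewrite sqr_ge0.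
have b0 : 0 <= b by apply: sumr_ge0 => i _; rewrite sqr_ge0.
have quad s t : \sum_i (s * f i + t * g i) ^+ 2 = s ^+ 2 * a + 2 * (s * t) * c + t ^+ 2 * b.
  rewrite !mulr_sumr -!big_split /=; apply: eq_bigr => i _; ring.
have quad0 s t : 0 <= s ^+ 2 * a + 2 * (s * t) * c + t ^+ 2 * b.
  by rewrite -quad; apply: sumr_ge0 => i _; rewrite sqr_ge0.
have fE : \sum_i (f i + g i) ^+ 2 = a + 2 * c + b.
  rewrite -[RHS](_ : 1 ^+ 2 * a + 2 * (1 * 1) * c + 1 ^+ 2 * b = _); last by ring.
  by rewrite -quad; apply: eq_bigr => i _; rewrite !mul1r.
have cauchy : c <= Num.sqrt a * Num.sqrt b.
  rewrite -sqrtrM //; apply: le_trans (ler_norm c) _.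
  rewrite -sqrtr_sqr ler_wsqrtr //.
  move: (a) (b) (c) a0 b0 quad0; clear => a b c a0 b0 quad0.
  have [b00|b00] := eqVneq b 0.
    (* The form then reads [s^2 a + 2 s t c >= 0], which at these values is
       [- (a + 2) c^2 >= 0]. *)
    have := quad0 c (- (a + 1)); rewrite b00; nra.
  have b1 : 0 < b by rewrite lt_neqAle eq_sym b00.
  have := quad0 b (- c); rewrite (_ : _ + _ = b * (a * b - c ^+ 2)); last by ring.
  by rewrite pmulr_rge0 // subr_ge0.
rewrite fE -[leRHS]ger0_norm ?addr_ge0 ?sqrtr_ge0 // -sqrtr_sqr ler_wsqrtr //.
by rewrite sqrrD !sqr_sqrtr //; lra.
Qed.

Lemma l2normE m (x : 'cV[R]_m) : l2norm x = Num.sqrt (\sum_i x i 0 ^+ 2).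
Proof. by rewrite /l2norm dotvv. Qed.

Lemma l2normD m (x y : 'cV[R]_m) : l2norm (x + y) <= l2norm x + l2norm y.
Proof.
rewrite !l2normE; apply: le_trans (minkowski_l2 _ _).
by apply/ler_wsqrtr/ler_sum => i _; rewrite mxE.
Qed.

Lemma l2normZ m a (x : 'cV[R]_m) : l2norm (a *: x) = `|a| * l2norm x.
Proof.
rewrite /l2norm dotvZr dotvZl mulrA -expr2 sqrtrM ?sqr_ge0 //.
by rewrite sqrtr_sqr.
Qed.

Lemma l2norm_orthogonal m (U : 'M[R]_m) x : orthogonal_mx U -> l2norm (U *m x) = l2norm x.
Proof. by move=> oU; rewrite /l2norm dotv_orthogonal. Qed.

Lemma l2norm0 m : l2norm (0 : 'cV[R]_m) = 0.
Proof. by rewrite -(scale0r (0 : 'cV[R]_m)) l2normZ normr0 mul0r. Qed.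

Lemma l2norm_diag_bound m (d : 'rV[R]_m) (c : R) x :
  (forall i, `|d 0 i| <= c) -> l2norm (diag_mx d *m x) <= c * l2norm x.
Proof.
move=> dc; rewrite !l2normE; case: m d x dc => [|m] d x dc.
  by rewrite !big_ord0 sqrtr0 mulr0.
have c0 : 0 <= c by apply: le_trans (dc 0); exact: normr_ge0.
rewrite -{1}(ger0_norm c0) -sqrtr_sqr -sqrtrM ?sqr_ge0 // ler_wsqrtr //.
rewrite mulr_sumr ler_sum // => i _; rewrite mul_diag_mx mxE exprMn.
by rewrite ler_wpM2r ?sqr_ge0 // -(real_normK (num_real (d 0 i))) lerXn2r ?nnegrE.
Qed.

(** The content is that the supremum is taken over a bounded set: the sum of
    the singular values is a bound. *)
Lemma l2norm_le_opnorm m (X : 'M[R]_m) x : l2norm x <= 1 -> l2norm (X *m x) <= opnorm X.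
Proof.
move=> x1; apply: sup_upper_bound; last by exists x.
split; first by exists (l2norm (X *m 0)), 0 => //; rewrite l2norm0.
have [U [V [d [oU oV d0 ->]]]] := singular_value_decomposition X.
exists (\sum_i d 0 i) => _ [y y1 ->].
have s0 : 0 <= \sum_i d 0 i by exact: sumr_ge0.
rewrite -!mulmxA l2norm_orthogonal //.
apply: (@le_trans _ _ ((\sum_i d 0 i) * l2norm (V^T *m y))).
  apply: l2norm_diag_bound => i; rewrite ger0_norm // (bigD1 i) //= lerDl.
  exact: sumr_ge0.
rewrite l2norm_orthogonal; last exact: orthogonal_tr.
by rewrite -[leRHS]mulr1 ler_wpM2l.
Qed.

Lemma opnorm_le m (X : 'M[R]_m) c :
  (forall x, l2norm x <= 1 -> l2norm (X *m x) <= c) -> opnorm X <= c.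
Proof.
move=> Xc; apply: ge_sup; last by move=> _ [x x1 ->]; exact: Xc.
by exists (l2norm (X *m 0)), 0 => //; rewrite l2norm0.
Qed.

Lemma opnorm_ge0 m (X : 'M[R]_m) : 0 <= opnorm X.
Proof.
by apply: le_trans (@l2norm_le_opnorm m X 0 _); rewrite ?mulmx0 ?l2norm0.
Qed.

Lemma opnormZ_le m a (X : 'M[R]_m) : opnorm (a *: X) <= `|a| * opnorm X.
Proof.
apply: opnorm_le => x x1; rewrite -scalemxAl l2normZ ler_wpM2l //.
exact: l2norm_le_opnorm.
Qed.

Lemma opnorm_mul_le m (U X V : 'M[R]_m) : orthogonal_mx U -> orthogonal_mx V ->
  opnorm (U *m X *m V) <= opnorm X.
Proof.
move=> oU oV; apply: opnorm_le => x x1; rewrite -!mulmxA l2norm_orthogonal //.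
by apply: l2norm_le_opnorm; rewrite l2norm_orthogonal.
Qed.

Lemma opnorm_invariant m : orthogonally_invariant_norm (@opnorm R m).
Proof.
split=> [a X|X Y|U X V oU oV].
- have [->|a0] := eqVneq a 0.
    apply/le_anti; rewrite (le_trans (opnormZ_le _ _)) //= normr0 mul0r.
    exact: opnorm_ge0.
  apply/le_anti; rewrite opnormZ_le /= -{1}[X](scalerK a0).
  by rewrite -ler_pdivlMl ?normr_gt0 // -normfV opnormZ_le.
- apply: opnorm_le => x x1; rewrite mulmxDl; apply: le_trans (l2normD _ _) _.
  by rewrite lerD // l2norm_le_opnorm.
- apply/le_anti; rewrite opnorm_mul_le //=.
  have {1}-> : X = U^T *m (U *m X *m V) *m V^T.
    by rewrite !mulmxA oU mul1mx -mulmxA orthogonal_mxV // mulmx1.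
  by apply: opnorm_mul_le; apply: orthogonal_tr.
Qed.

Lemma norm_diag_entry_le_opnorm m (X : 'M[R]_m) i : `|X i i| <= opnorm X.
Proof.
apply: le_trans (@l2norm_le_opnorm m X (delta_mx i 0) _).
  rewrite -colE l2normE -sqrtr_sqr ler_wsqrtr // (bigD1 i) //= mxE lerDl.
  by apply: sumr_ge0 => j _; rewrite sqr_ge0.
rewrite l2normE (bigD1 i) //= big1 ?addr0 => [|j /negPf ji]; last first.
  by rewrite mxE ji expr0n.
by rewrite mxE !eqxx expr1n sqrtr1.
Qed.

Lemma norm_eigenvalue_le_opnorm m (U : 'M[R]_m) (d : 'rV[R]_m) i :
  orthogonal_mx U -> `|d 0 i| <= opnorm (U *m diag_mx d *m U^T).
Proof.
move=> oU; rewrite (oin_svd (opnorm_invariant m)) //.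
by apply: le_trans (norm_diag_entry_le_opnorm _ i); rewrite mxE eqxx mulr1n.
Qed.

Lemma opnorm_sqrtmx_absmx m (H : 'M[R]_m) :
  H^T = H -> opnorm (sqrtmx (absmx H)) <= Num.sqrt (opnorm H).
Proof.
move=> /spectral[U [d [oU ->]]].
rewrite absmx_conj // sqrtmx_conj; [|done|by move=> i; rewrite mxE].
rewrite [X in X <= _](oin_svd (opnorm_invariant m)) //.
apply: opnorm_le => x x1; rewrite -[leRHS]mulr1.
apply: le_trans (ler_wpM2l (sqrtr_ge0 _) x1).
apply: l2norm_diag_bound => i; rewrite !mxE ger0_norm ?sqrtr_ge0 // ler_wsqrtr //.
exact: norm_eigenvalue_le_opnorm.
Qed.

(** In an eigenbasis of [S] the factor becomes diagonal, and the bound is that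
    of [oin_diag_bound]. *)
Lemma oin_mull_opnorm m (N : 'M[R]_m -> R) S X :
  orthogonally_invariant_norm N -> S^T = S -> N (S *m X) <= opnorm S * N X.
Proof.
move=> hN /spectral[U [d [oU ->]]].
rewrite -[N X](oin_mull hN X (orthogonal_tr oU)).
rewrite -[X in N X <= _]mulmxA -[X in N X <= _]mulmxA (oin_mull hN) //.
apply: (oin_diag_bound hN); last exact: opnorm_ge0.
by move=> i; exact: norm_eigenvalue_le_opnorm.
Qed.

Lemma oin_trmx m (N : 'M[R]_m -> R) :
  orthogonally_invariant_norm N -> orthogonally_invariant_norm (fun X => N X^T).
Proof.
move=> hN; split=> [a X|X Y|U X V oU oV].
- by rewrite linearZ /= (oin_scale hN).
- by rewrite linearD /=; exact: oin_triangle.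
- by rewrite !trmx_mul mulmxA (oin_orthogonal hN) //; exact: orthogonal_tr.
Qed.

Lemma oin_mulr_opnorm m (N : 'M[R]_m -> R) S X :
  orthogonally_invariant_norm N -> S^T = S -> N (X *m S) <= opnorm S * N X.
Proof.
move=> hN ST; have := oin_mull_opnorm X^T (oin_trmx hN) ST.
by rewrite trmx_mul !trmxK ST.
Qed.

Definition frobenius m (X : 'M[R]_m) : R := Num.sqrt (\tr (X^T *m X)).

Lemma trace_gram m (X : 'M[R]_m) :
  \tr (X^T *m X) = \sum_(p : 'I_m * 'I_m) X p.1 p.2 ^+ 2.
Proof.
rewrite -(pair_bigA _ (fun i j => X i j ^+ 2)) exchange_big /=.
apply: eq_bigr => j _; rewrite mxE; apply: eq_bigr => i _.
by rewrite mxE expr2.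
Qed.

Lemma frobenius_invariant m : orthogonally_invariant_norm (@frobenius m).
Proof.
split=> [a X|X Y|U X V oU oV].
- rewrite /frobenius [(_ *: _)^T]linearZ /= -scalemxAl -scalemxAr scalerA mxtraceZ -expr2.
  by rewrite sqrtrM ?sqr_ge0 // sqrtr_sqr.
- rewrite /frobenius !trace_gram; apply: le_trans (minkowski_l2 _ _).
  by apply/ler_wsqrtr/ler_sum => p _; rewrite mxE.
- rewrite /frobenius !trmx_mul -!mulmxA [U^T *m _]mulmxA oU mul1mx.
  by rewrite mxtrace_mulC -!mulmxA orthogonal_mxV // mulmx1.
Qed.

Lemma frobenius_diag_mx m (d : 'rV[R]_m) :
  frobenius (diag_mx d) = Num.sqrt (\sum_i d 0 i ^+ 2).
Proof.
rewrite /frobenius tr_diag_mx mulmx_diag mxtrace_diag; congr Num.sqrt.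
by apply: eq_bigr => i _; rewrite mxE expr2.
Qed.

Lemma frobenius_sqrtmx_absmx m (H : 'M[R]_m) :
  frobenius (sqrtmx (absmx H)) = Num.sqrt (\tr (absmx H)).
Proof.
have [pH _] := sqrtmxP (psd_gram H).
by have [[ST _] SS] := sqrtmxP pH; rewrite /frobenius ST SS.
Qed.

Lemma real_restriction_invariant m (N : 'M[R[i]]_m -> R) :
  unitarily_invariant_norm N -> orthogonally_invariant_norm (fun X => N (toC X)).
Proof.
move=> hN; have unitary_toC (U : 'M[R]_m) : orthogonal_mx U -> toC U \is unitarymx.
  move=> oU; apply/unitarymxP.
  have -> : map_mx Num.conj (toC U)^T = toC U^T.
    by apply/matrixP => i j; rewrite !mxE; exact: conjc_real.
  by rewrite /toC -map_mxM orthogonal_mxV // map_mx1.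
split=> [a X|X Y|U X V oU oV].
- rewrite /toC map_mxZ (uin_scale hN) /= expr0n addr0.
  by rewrite sqrtr_sqr.
- by rewrite /toC map_mxD; exact: uin_triangle.
- by rewrite /toC !map_mxM (uin_unitary hN) //; exact: unitary_toC.
Qed.

End Norms.

(** * Pairs of singular values of a skew-symmetric matrix *)

Section Skew.
Context {R : realType}.

Lemma det_skew_odd p (L : 'M[R]_p) : odd p -> L^T = - L -> \det L = 0.
Proof.
move=> op LT; have : \det L = - \det L.
  by rewrite -{1}det_tr LT -scaleN1r detZ -signr_odd op expr1 mulN1r.
by move=> h; lra.
Qed.

(** In an orthonormal basis of right singular vectors, [X] is a skew matrix [K]
    that commutes with [K^2 = - diag x^2], hence preserves the eigenspaces of
    the latter.  If [x] dropped after an odd number of entries, the leading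
    block of [K] of that odd size would be skew and invertible. *)
Lemma skew_singular_pairs m (X : 'M[R]_m) (j k : 'I_m) :
  X^T = - X -> ~~ odd j -> k = j.+1 :> nat ->
  eigvals (absmx X) 0 j = eigvals (absmx X) 0 k.
Proof.
move=> XT oj kj; have [U [V [oU oV sx x0 EX]]] := eigvals_absmx X.
move: (eigvals _) sx x0 EX => x sx x0 EX.
apply/le_anti; rewrite [X in _ && X]sx ?kj // andbT leNgt; apply/negP => xkj.
pose K := V^T *m X *m V.
have KT : K^T = - K by rewrite /K !trmx_mul trmxK XT mulNmx mulmxN mulmxA.
have KK : K *m K = - diag_mx (map_mx (fun a => a ^+ 2) x).
  have -> : K *m K = - (V^T *m (X^T *m X) *m V).
    rewrite XT mulNmx mulmxN mulNmx opprK /K !mulmxA -[_ *m V *m V^T]mulmxA.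
    by rewrite orthogonal_mxV // mulmx1.
  congr (- _); rewrite {1 2}EX !trmx_mul trmxK tr_diag_mx !mulmxA oV mul1mx.
  rewrite -[_ *m V^T *m V]mulmxA oV mulmx1 -[_ *m U^T *m U]mulmxA oU mulmx1.
  by rewrite mulmx_diag; congr diag_mx; apply/rowP => i; rewrite !mxE expr2.
clearbody K; have K0 (a b : 'I_m) : (a <= j)%N -> (j < b)%N -> K a b = 0.
  move=> aj jb; have : K *m (K *m K) = K *m K *m K by rewrite mulmxA.
  rewrite KK mulmxN mulNmx => /oppr_inj; rewrite mul_mx_diag mul_diag_mx.
  move=> /matrixP/(_ a b); rewrite !mxE => h.
  have xab : x 0 b < x 0 a.
    by apply: le_lt_trans (lt_le_trans xkj (sx _ _ aj)); apply: sx; rewrite kj.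
  have : (x 0 a ^+ 2 - x 0 b ^+ 2) * K a b = 0 by rewrite mulrBl -h mulrC subrr.
  move=> /eqP; rewrite mulf_eq0 => /orP[|/eqP //].
  by rewrite subr_eq0 gt_eqF // ltrXn2r ?nnegrE.
have jm : (j.+1 <= m)%N by exact: ltn_ord.
pose w := widen_ord jm; pose L := mxsub w w K.
have LT : L^T = - L.
  by apply/matrixP => a b; rewrite !mxE; have /matrixP/(_ (w a) (w b)) := KT; rewrite !mxE.
have LL : L *m L = diag_mx (\row_a (- x 0 (w a) ^+ 2)).
  apply/matrixP => a b; rewrite mxE.
  have /matrixP/(_ (w a) (w b)) := KK; rewrite !mxE => h.
  transitivity (\sum_l K (w a) l * K l (w b)).
    rewrite [RHS](bigID (fun l : 'I_m => (l < j.+1)%N)) /=.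
    rewrite [X in _ = _ + X]big1 ?addr0; last first.
      move=> l; rewrite -leqNgt => jl; rewrite K0 ?mul0r //.
      by rewrite -ltnS; exact: (ltn_ord a).
    by rewrite (big_ord_narrow jm); apply: eq_bigr => l _; rewrite !mxE.
  by rewrite h mulNrn -val_eqE.
have : \det (L *m L) = 0 by rewrite det_mulmx det_skew_odd ?mul0r //= oj.
rewrite LL det_diag => /eqP; rewrite prodf_seq_eq0 => /hasP[a _ /=].
rewrite mxE oppr_eq0 sqrf_eq0 gt_eqF // (le_lt_trans (x0 k)) //.
by apply: lt_le_trans xkj _; apply: sx; rewrite -ltnS; exact: (ltn_ord a).
Qed.

Lemma sum_pairs n (f : 'I_(n + n) -> R) (h : 'I_n -> R) :
  (forall (i : 'I_n) (j : 'I_(n + n)), j = i.*2 :> nat -> f j = h i) ->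
  (forall (i : 'I_n) (j : 'I_(n + n)), j = i.*2.+1 :> nat -> f j = h i) ->
  \sum_j f j = 2 * \sum_i h i.
Proof.
move=> f0 f1.
(* [f] as a function on [nat], with value [0] outside its domain. *)
pose F k := if insub k is Some j then f j else 0.
have Fsum p : \sum_(k < p + p) F k = \sum_(i < p) (F i.*2 + F i.*2.+1).
  elim: p => [|p IH]; first by rewrite !big_ord0.
  by rewrite addSn addnS !big_ord_recr /= IH addnn addrA.
transitivity (\sum_(k < n + n) F k).
  by apply: eq_bigr => j _; rewrite /F valK.
rewrite Fsum mulr_sumr; apply: eq_bigr => i _.
have i0 : (i.*2 < n + n)%N by have := ltn_ord i; lia.
have i1 : (i.*2.+1 < n + n)%N by have := ltn_ord i; lia.
rewrite /F !insubT /= (f0 i) // (f1 i) //; ring.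
Qed.

End Skew.

(** * The perturbation bound *)

Section Perturbation.
Context {R : realType} {n : nat}.
Implicit Types (A B S P Q : 'M[R]_(n + n)).

Lemma Jmx_tr : (Jmx R n)^T = - Jmx R n.
Proof.
by rewrite /Jmx tr_block_mx opp_block_mx !trmx0 trmx1 !oppr0 linearN /= trmx1 opprK.
Qed.

Lemma orthogonal_Jmx : orthogonal_mx (Jmx R n).
Proof.
rewrite /orthogonal_mx Jmx_tr /Jmx opp_block_mx mulmx_block !oppr0 opprK.
by rewrite !mul0mx !mulmx0 !add0r !addr0 mulNmx mulmxN opprK !mulmx1 -scalar_mx_block.
Qed.

(** For a square root [S] of a positive semidefinite matrix, the matrix whose
    singular values enter [Dhat]. *)
Definition sandwich S : 'M[R]_(n + n) := S *m Jmx R n *m S.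

Lemma sandwich_tr S : S^T = S -> (sandwich S)^T = - sandwich S.
Proof. by move=> ST; rewrite !trmx_mul Jmx_tr ST mulNmx mulmxN mulmxA. Qed.

Lemma sandwich_perturbation (N : 'M[R]_(n + n) -> R) P Q :
  orthogonally_invariant_norm N -> psd P -> psd Q ->
  N (sandwich (sqrtmx P) - sandwich (sqrtmx Q)) <=
    (opnorm (sqrtmx P) + opnorm (sqrtmx Q)) * N (sqrtmx (absmx (P - Q))).
Proof.
move=> hN pP pQ; apply: (@le_trans _ _
    ((opnorm (sqrtmx P) + opnorm (sqrtmx Q)) * N (sqrtmx P - sqrtmx Q))); last first.
  by rewrite ler_wpM2l ?addr_ge0 ?opnorm_ge0 //; exact: sqrtmx_perturbation.
have [[ST _] _] := sqrtmxP pP; have [[TT _] _] := sqrtmxP pQ.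
move: (sqrtmx P) (sqrtmx Q) ST TT => S T ST TT.
have -> : sandwich S - sandwich T =
    S *m (Jmx R n *m (S - T)) + (S - T) *m Jmx R n *m T.
  by rewrite /sandwich !mulmxBr mulmxBl mulmxBl !mulmxA addrA subrK.
apply: le_trans (oin_triangle hN _ _) _; rewrite mulrDl; apply: lerD.
  apply: le_trans (oin_mull_opnorm _ hN ST) _.
  by rewrite (oin_mull hN) //; exact: orthogonal_Jmx.
apply: le_trans (oin_mulr_opnorm _ hN TT) _.
by rewrite (oin_mulr hN) //; exact: orthogonal_Jmx.
Qed.

Lemma Dhat_perturbation (N : 'M[R]_(n + n) -> R) A B :
  orthogonally_invariant_norm N -> A^T = A -> B^T = B ->
  N (Dhat A - Dhat B) <=
    (opnorm (sqrtmx (pospart A)) + opnorm (sqrtmx (pospart B)))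
      * N (sqrtmx (absmx (pospart A - pospart B)))
    + (opnorm (sqrtmx (negpart A)) + opnorm (sqrtmx (negpart B)))
      * N (sqrtmx (absmx (negpart A - negpart B))).
Proof.
move=> hN AT BT; rewrite /Dhat opprD addrACA.
apply: le_trans (oin_triangle hN _ _) _; apply: lerD.
  apply: le_trans (mirsky hN _ _) _.
  by apply: sandwich_perturbation => //; exact: psd_pospart.
apply: le_trans (mirsky_opp hN _ _) _.
by apply: sandwich_perturbation => //; exact: psd_negpart.
Qed.

Lemma Dhat_diag A : exists d, Dhat A = diag_mx d.
Proof. by eexists; rewrite /Dhat /Eig -linearD. Qed.

(** The reversal of indices in the negative part maps each pair of places
    [2 i], [2 i + 1] to such a pair, because the dimension is even. *)
Lemma Dhat_pairs A (i : 'I_n) (j : 'I_(n + n)) :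
  A^T = A -> j = i.*2.+1 :> nat -> Dhat A j j = sympd A i.
Proof.
move=> AT ji; rewrite /sympd; set k := Ordinal _.
have jk : j = k.+1 :> nat by [].
have [pP _] := sqrtmxP (psd_pospart AT); have [pQ _] := sqrtmxP (psd_negpart AT).
rewrite /Dhat -!/(sandwich _) /Eig eigvals_opp_absmx !mxE !eqxx !mulr1n !permE.
congr (_ - _).
  symmetry; apply: skew_singular_pairs => //; last by rewrite /= odd_double.
  exact: sandwich_tr pP.1.
by apply: skew_singular_pairs; rewrite /= ?ji; [exact: sandwich_tr pQ.1|lia|have := ltn_ord i; lia].
Qed.

End Perturbation.

Theorem proposition5p4 (R : realType) (n : nat) (A B : 'M[R]_(n + n))
    (hA : EigSpSm A) (hB : EigSpSm B) :
  [/\ (forall N : 'M[R[i]]_(n + n) -> R, unitarily_invariant_norm N ->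
        N (toC (Dhat A - Dhat B)) <=
          (opnorm (sqrtmx (pospart A)) + opnorm (sqrtmx (pospart B)))
            * N (toC (sqrtmx (absmx (pospart A - pospart B))))
          + (opnorm (sqrtmx (negpart A)) + opnorm (sqrtmx (negpart B)))
            * N (toC (sqrtmx (absmx (negpart A - negpart B))))),
      \big[Num.max/0]_(i < n) `|sympd A i - sympd B i| <=
        (opnorm (sqrtmx (pospart A)) + opnorm (sqrtmx (pospart B)))
          * Num.sqrt (opnorm (pospart A - pospart B))
        + (opnorm (sqrtmx (negpart A)) + opnorm (sqrtmx (negpart B)))
          * Num.sqrt (opnorm (negpart A - negpart B))
    & Num.sqrt 2 * Num.sqrt (\sum_(i < n) `|sympd A i - sympd B i| ^+ 2) <=
        (opnorm (sqrtmx (pospart A)) + opnorm (sqrtmx (pospart B)))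
          * Num.sqrt (\tr (absmx (pospart A - pospart B)))
        + (opnorm (sqrtmx (negpart A)) + opnorm (sqrtmx (negpart B)))
          * Num.sqrt (\tr (absmx (negpart A - negpart B)))].
Proof.
have AT : A^T = A by case: hA.
have BT : B^T = B by case: hB.
have sym2 (X Y : 'M[R]_(n + n)) : psd X -> psd Y -> (X - Y)^T = X - Y.
  by move=> [XT _] [YT _]; rewrite linearB /= XT YT.
split.
- by move=> N /real_restriction_invariant hN; exact: Dhat_perturbation hN AT BT.
- apply: (@le_trans _ _ (opnorm (Dhat A - Dhat B))).
    apply: bigmax_le => [|i _]; first exact: opnorm_ge0.
    rewrite /sympd; move: (Dhat A) (Dhat B) (Ordinal _) => X Y k.
    by have := norm_diag_entry_le_opnorm (X - Y) k; rewrite !mxE.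
  apply: le_trans (Dhat_perturbation (opnorm_invariant _) AT BT) _.
  apply: lerD; apply: ler_wpM2l; rewrite ?addr_ge0 ?opnorm_ge0 //;
    apply: opnorm_sqrtmx_absmx; apply: sym2; by [exact: psd_pospart|exact: psd_negpart].
- have := Dhat_perturbation (frobenius_invariant _) AT BT.
  rewrite !frobenius_sqrtmx_absmx; apply: le_trans.
  have [g Eg] : exists g, Dhat A - Dhat B = diag_mx g.
    have [a ->] := Dhat_diag A; have [b ->] := Dhat_diag B.
    by exists (a - b); rewrite linearB.
  have gE j : g 0 j = Dhat A j j - Dhat B j j.
    move: (Dhat A) (Dhat B) Eg => X Y /matrixP/(_ j j).
    by rewrite !mxE eqxx mulr1n => <-.
  rewrite Eg frobenius_diag_mx -sqrtrM ?ler0n // ler_wsqrtr //.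
  rewrite (sum_pairs (h := fun i => `|sympd A i - sympd B i| ^+ 2)) //.
  + move=> i j ji; rewrite gE real_normK ?num_real // /sympd.
    by rewrite (_ : j = Ordinal (double_idx_subproof i)) //; exact: val_inj.
  + move=> i j ji; rewrite real_normK ?num_real //; congr (_ ^+ 2).
    by apply: etrans (gE j) (f_equal2 (fun a b => a - b) _ _); exact: Dhat_pairs.
Qed.
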